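(* For arbitrary measures $\mu$ and $\nu$, the pair $(L_1(\mu),L_1(\nu))$ (both spaces over the same scalar field $\mathbb{R}$ or $\mathbb{C}$) has the BPBZp.
   Context: $S_X$ is the unit sphere of a Banach space $X$, $X^*$ its topological dual, $\mathcal{L}(X,Y)$ the bounded linear operators from $X$ to $Y$. BPBZp (Bishop-Phelps-Bollobás-Zizler property): a pair $(X,Y)$ of Banach spaces has the BPBZp if for every $\varepsilon>0$ there exists $\eta(\varepsilon)>0$ such that whenever $T\in\mathcal{L}(X,Y)$ with $\|T\|=1$, $y_0^*\in S_{Y^*}$ and $x_0\in S_X$ satisfy $|y_0^*(Tx_0)|>1-\eta(\varepsilon)$, there exist $y_1^*\in S_{Y^*}$, $x_1\in S_X$ and $S\in\mathcal{L}(X,Y)$ with $\|S\|=|y_1^*(Sx_1)|=1$, $\|x_1-x_0\|<\varepsilon$, $\|y_1^*-y_0^*\|<\varepsilon$ and $\|S-T\|<\varepsilon$. *)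

(* Defs.v *)
From HB Require Import structures.
From mathcomp Require Import all_boot all_order all_algebra.
From mathcomp Require Import generic_quotient ring_quotient.
From mathcomp Require Import complex lra.
From mathcomp Require Import all_classical all_reals all_analysis measurable_realfun.

Set Implicit Arguments.
Unset Strict Implicit.
Unset Printing Implicit Defensive.

Import Order.TTheory GRing.Theory Num.Theory.
Import numFieldNormedType.Exports.
Export numFieldNormedType.Exports.

Local Open Scope classical_set_scope.
Local Open Scope ring_scope.

Variant scalarKind := RealScalars | ComplexScalars.

Definition scalarField (R : realType) (k : scalarKind) : numFieldType :=
  match k with RealScalars => R | ComplexScalars => R[i] end.

Section ScalarParts.
Variables (R : realType) (k : scalarKind).

Definition re_part : scalarField R k -> R :=
  match k with RealScalars => fun x => x | ComplexScalars => @complex.Re R end.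

Definition im_part : scalarField R k -> R :=
  match k with RealScalars => fun=> 0 | ComplexScalars => @complex.Im R end.

Definition of_real : R -> scalarField R k :=
  match k with RealScalars => fun x => x | ComplexScalars => fun x => Complex x 0 end.

(* Norms over [scalarField R k] take their values in [scalarField R k]; [rnorm] is the
   modulus as an element of [R]. *)
Definition rnorm (z : scalarField R k) : R := re_part `|z|.

Lemma re_partD x y : re_part (x + y) = re_part x + re_part y.
Proof. by rewrite /re_part; destruct k => //=; case: x; case: y. Qed.

Lemma im_partD x y : im_part (x + y) = im_part x + im_part y.
Proof. by rewrite /im_part; destruct k => //=; [rewrite addr0|case: x; case: y]. Qed.

Lemma re_partM x y :
  re_part (x * y) = re_part x * re_part y - im_part x * im_part y.
Proof.
by rewrite /re_part/im_part; destruct k => //=; [rewrite mulr0 subr0|case: x; case: y].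
Qed.

Lemma im_partM x y :
  im_part (x * y) = re_part x * im_part y + im_part x * re_part y.
Proof.
rewrite /re_part/im_part; destruct k => //=; first by rewrite mulr0 mul0r addr0.
by case: x => a b; case: y => c d.
Qed.

Lemma of_real_rnorm z : of_real (rnorm z) = `|z|.
Proof. by rewrite /of_real/rnorm/re_part; destruct k. Qed.

Lemma rnormE z : rnorm z = Num.sqrt (re_part z ^+ 2 + im_part z ^+ 2).
Proof.
rewrite /rnorm/re_part/im_part; destruct k => /=.
- by rewrite expr0n /= addr0 sqrtr_sqr.
- by case: z.
Qed.

Lemma of_realD x y : of_real (x + y) = of_real x + of_real y.
Proof.
by rewrite /of_real; destruct k => //=; apply/eqP; rewrite eq_complex/= addr0 !eqxx.
Qed.

Lemma of_realM x y : of_real (x * y) = of_real x * of_real y.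
Proof.
rewrite /of_real; destruct k => //=; apply/eqP.
by rewrite eq_complex/= !mulr0 mul0r subr0 addr0 !eqxx.
Qed.

Lemma ler_of_real x y : (of_real x <= of_real y) = (x <= y).
Proof. by rewrite /of_real; destruct k => //=; rewrite lecR. Qed.

Lemma ltr_of_real x y : (of_real x < of_real y) = (x < y).
Proof. by rewrite /of_real; destruct k => //=; rewrite ltcR. Qed.

Lemma of_real0 : of_real 0 = 0.
Proof. by rewrite /of_real; destruct k. Qed.

Lemma re_part_of_real x : re_part (of_real x) = x.
Proof. by rewrite /of_real/re_part; destruct k. Qed.

End ScalarParts.

Section L1.
Context d (T : measurableType d) (R : realType) (k : scalarKind).
Variable mu : {measure set T -> \bar R}.
Notation K := (scalarField R k).

Definition absint (f : T -> K) : \bar R := (\int[mu]_x (rnorm (f x))%:E)%E.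

Definition integrable_fun (f : T -> K) : Prop :=
  [/\ measurable_fun setT (@re_part R k \o f),
      measurable_fun setT (@im_part R k \o f) &
      (absint f < +oo)%E].

(* [K^o] is [K] as a module over itself, which makes [T -> K^o] a [K]-module. *)
Definition L1pred : {pred T -> K^o} := [pred f | `[< integrable_fun f >]].

Lemma rnorm_ge0 (z : K) : 0 <= rnorm z.
Proof. by rewrite rnormE sqrtr_ge0. Qed.

Lemma measurable_rnorm (f : T -> K) :
  measurable_fun setT (@re_part R k \o f) ->
  measurable_fun setT (@im_part R k \o f) ->
  measurable_fun setT (EFin \o (@rnorm R k \o f)).
Proof.
move=> mr mi; apply/measurable_EFinP.
rewrite (_ : _ \o _ = Num.sqrt \o ((fun x => (re_part (f x)) ^+ 2) \+ (fun x => (im_part (f x)) ^+ 2))); last first.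
  by apply/funext => x /=; rewrite rnormE.
have m2 : measurable_fun setT ((fun x => (re_part (f x)) ^+ 2) \+ (fun x => (im_part (f x)) ^+ 2)).
  by apply: measurable_funD; apply: measurable_funX.
apply: measurableT_comp m2; apply: continuous_measurable_fun; exact: sqrt_continuous.
Qed.

Lemma rnormD (x y : K) : rnorm (x + y) <= rnorm x + rnorm y.
Proof. by rewrite -(ler_of_real k) of_realD !of_real_rnorm ler_normD. Qed.

Lemma rnormM (x y : K) : rnorm (x * y) = rnorm x * rnorm y.
Proof.
have inj : injective (@of_real R k) by exact: can_inj (@re_part_of_real R k).
by apply: inj; rewrite of_realM !of_real_rnorm normrM.
Qed.

Lemma rnorm0 : rnorm (0 : K) = 0.
Proof. by rewrite /rnorm normr0 -(of_real0 R k) re_part_of_real. Qed.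

Lemma absintD (f g : T -> K) : integrable_fun f -> integrable_fun g ->
  (absint (fun x => f x + g x)%R <= absint f + absint g)%E.
Proof.
move=> [f1 f2 _] [g1 g2 _]; rewrite /absint -ge0_integralD//; first last.
- exact: measurable_rnorm.
- by move=> x _; rewrite lee_fin rnorm_ge0.
- exact: measurable_rnorm.
- by move=> x _; rewrite lee_fin rnorm_ge0.
apply: ge0_le_integral => //.
- by move=> x _; rewrite lee_fin rnorm_ge0.
- apply: (@measurable_rnorm (fun x => f x + g x)).
  + rewrite (_ : _ \o _ = (@re_part R k \o f) \+ (@re_part R k \o g)); last first.
      by apply/funext => x /=; rewrite re_partD.
    exact: measurable_funD.
  + rewrite (_ : _ \o _ = (@im_part R k \o f) \+ (@im_part R k \o g)); last first.
      by apply/funext => x /=; rewrite im_partD.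
    exact: measurable_funD.
- by apply: emeasurable_funD; exact: measurable_rnorm.
- by move=> x _; rewrite -EFinD lee_fin rnormD.
Qed.

Lemma absintZ (a : K) (f : T -> K) : integrable_fun f ->
  absint (fun x => a * f x) = ((rnorm a)%:E * absint f)%E.
Proof.
move=> [f1 f2 _]; rewrite /absint -ge0_integralZl//.
- by apply: eq_integral => x _; rewrite rnormM EFinM.
- exact: measurable_rnorm.
- by move=> x _; rewrite lee_fin rnorm_ge0.
- by rewrite lee_fin rnorm_ge0.
Qed.

Lemma absint_ge0 (f : T -> K) : (0 <= absint f)%E.
Proof. by apply: integral_ge0 => x _; rewrite lee_fin rnorm_ge0. Qed.

Lemma L1pred_submod : submod_closed L1pred.
Proof.
split.
  apply/asboolP; split.
  - rewrite (_ : _ \o _ = cst (re_part (0 : K)))//.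
  - rewrite (_ : _ \o _ = cst (im_part (0 : K)))//.
  - rewrite /absint (eq_integral (cst 0%E)) ?integral0//.
    by move=> x _; rewrite /= rnorm0.
move=> a f g /asboolP If /asboolP Ig; apply/asboolP.
have [f1 f2 f3] := If; have [g1 g2 g3] := Ig.
have Iaf : integrable_fun (fun x => a * f x).
  split.
  - rewrite (_ : _ \o _ = (fun x => re_part a * re_part (f x) - im_part a * im_part (f x))); last first.
      by apply/funext => x /=; rewrite re_partM.
    by apply: measurable_funB; apply: measurable_funM.
  - rewrite (_ : _ \o _ = (fun x => re_part a * im_part (f x) + im_part a * re_part (f x))); last first.
      by apply/funext => x /=; rewrite im_partM.
    by apply: measurable_funD; apply: measurable_funM.
  - rewrite absintZ//; apply: lte_mul_pinfty => //; by rewrite lee_fin rnorm_ge0.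
have [h1 h2 h3] := Iaf.
split.
- rewrite (_ : _ \o _ = (@re_part R k \o (fun x => a * f x)) \+ (@re_part R k \o g)); last first.
    by apply/funext => x /=; rewrite re_partD.
  exact: measurable_funD.
- rewrite (_ : _ \o _ = (@im_part R k \o (fun x => a * f x)) \+ (@im_part R k \o g)); last first.
    by apply/funext => x /=; rewrite im_partD.
  exact: measurable_funD.
- apply: le_lt_trans (absintD Iaf Ig) _.
  exact: lte_add_pinfty.
Qed.

HB.instance Definition _ :=
  GRing.isSubmodClosed.Build K (T -> K^o) L1pred L1pred_submod.

Record L1fun := MkL1fun { L1fun_val :> T -> K^o; L1fun_valP : L1fun_val \in L1pred }.
HB.instance Definition _ := [isSub for L1fun_val].
HB.instance Definition _ := [Choice of L1fun by <:].
HB.instance Definition _ := [SubChoice_isSubLmodule of L1fun by <:].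

Definition null_fun : {pred L1fun} := [pred f : L1fun | `[< {ae mu, forall x, f x = 0} >]].

Lemma null_fun_zmod : zmod_closed null_fun.
Proof.
split; first by apply/asboolP; exact: nearW.
move=> f g /asboolP f0 /asboolP g0; apply/asboolP.
move: f0 g0; apply: filterS2 => x fx gx.
have -> : (f - g) x = f x - g x by [].
by rewrite fx gx subrr.
Qed.
HB.instance Definition _ := GRing.isZmodClosed.Build L1fun null_fun null_fun_zmod.

Definition L1 : Type := Quotient.quot null_fun.
HB.instance Definition _ := Choice.on L1.
HB.instance Definition _ := GRing.Zmodule.on L1.
HB.instance Definition _ := EqQuotient.on L1.

Local Open Scope quotient_scope.

Lemma eq_L1P (f g : L1fun) :
  reflect {ae mu, forall x, f x = g x} (f == g %[mod L1]).
Proof.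
rewrite -[_ == _ %[mod _]]Quotient.idealrBE; apply: (iffP (asboolP _)).
- by apply: filterS => x /= fg; apply/eqP; rewrite -subr_eq0; apply/eqP.
- by apply: filterS => x /= fg; apply/eqP; rewrite subr_eq0; apply/eqP.
Qed.

Definition L1scale (a : K) (u : L1) : L1 := \pi_L1 (a *: repr u).

Lemma L1scale_pi a (f : L1fun) : L1scale a (\pi_L1 f) = \pi_L1 (a *: f).
Proof.
apply/eqP/eq_L1P.
have /eqP/eq_L1P : repr (\pi_L1 f) = f %[mod L1] by rewrite reprK.
apply: filterS => x fg.
by rewrite [LHS](_ : _ = a * repr (\pi_L1 f) x)// fg.
Qed.

Lemma L1pi_add (f g : L1fun) : \pi_L1 (f + g) = \pi_L1 f + \pi_L1 g.
Proof. exact: Quotient.pi_add. Qed.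

Lemma L1pi_opp (f : L1fun) : \pi_L1 (- f) = - \pi_L1 f.
Proof. exact: Quotient.pi_opp. Qed.

Lemma L1scaleA a b u : L1scale a (L1scale b u) = L1scale (a * b) u.
Proof. by elim/quotW: u => f; rewrite (L1scale_pi b) !L1scale_pi scalerA. Qed.
Lemma L1scale1 : left_id 1 L1scale.
Proof. by elim/quotW => f; rewrite !L1scale_pi scale1r. Qed.
Lemma L1scaleDr : right_distributive L1scale +%R.
Proof.
move=> a; elim/quotW => f; elim/quotW => g.
by rewrite -L1pi_add !L1scale_pi scalerDr L1pi_add.
Qed.
Lemma L1scaleDl u : {morph L1scale^~ u : a b / a + b}.
Proof. by elim/quotW: u => f a b; rewrite !L1scale_pi scalerDl L1pi_add. Qed.

HB.instance Definition _ := GRing.Zmodule_isLmodule.Build K L1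
  L1scaleA L1scale1 L1scaleDr L1scaleDl.

Definition L1norm (u : L1) : K := of_real k (fine (absint (repr u))).

Lemma L1funP (f : L1fun) : integrable_fun f.
Proof. exact/asboolP/(L1fun_valP f). Qed.

Lemma eq_absint (f g : L1fun) : f = g %[mod L1] -> absint f = absint g.
Proof.
move/eqP/eq_L1P => fg.
have [f1 f2 _] := L1funP f; have [g1 g2 _] := L1funP g.
apply: ge0_ae_eq_integral => //.
- exact: measurable_rnorm.
- exact: measurable_rnorm.
- by move=> x _; rewrite lee_fin rnorm_ge0.
- by move=> x _; rewrite lee_fin rnorm_ge0.
- by move: fg; apply: filterS => x /= ->.
Qed.

Lemma L1norm_pi (f : L1fun) : L1norm (\pi_L1 f) = of_real k (fine (absint f)).
Proof. by rewrite /L1norm (@eq_absint (repr (\pi_L1 f)) f) ?reprK. Qed.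

Lemma absint_fin_num (f : L1fun) : absint f \is a fin_num.
Proof. by rewrite ge0_fin_numE ?absint_ge0//; case: (L1funP f). Qed.

Lemma L1normD u v : L1norm (u + v) <= L1norm u + L1norm v.
Proof.
elim/quotW: u => f; elim/quotW: v => g.
rewrite -L1pi_add !L1norm_pi -of_realD ler_of_real -fineD ?absint_fin_num//.
have fin_fg : (absint f + absint g)%E \is a fin_num.
  by have := conj (absint_fin_num f) (absint_fin_num g) => /andP; rewrite -fin_numD.
apply: fine_le => //; first exact: absint_fin_num.
exact: (absintD (L1funP f) (L1funP g)).
Qed.

Lemma L1normZ a u : L1norm (a *: u) = `|a| * L1norm u.
Proof.
elim/quotW: u => f; rewrite [_ *: _]L1scale_pi !L1norm_pi -of_real_rnorm -of_realM.
have -> : absint (a *: f) = ((rnorm a)%:E * absint f)%E by exact: (absintZ a (L1funP f)).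
by rewrite fineM ?absint_fin_num.
Qed.

Lemma rnorm_eq0 (z : K) : rnorm z = 0 -> z = 0.
Proof.
by move=> z0; apply/normr0_eq0; rewrite -of_real_rnorm z0 of_real0.
Qed.

Lemma L1norm0_eq0 u : L1norm u = 0 -> u = 0.
Proof.
elim/quotW: u => f; rewrite L1norm_pi -(of_real0 R k) => /(can_inj (@re_part_of_real R k)) f0.
have [f1 f2 _] := L1funP f.
have {}f0 : absint f = 0%E by rewrite -(fineK (absint_fin_num f)) f0.
have : ae_eq mu setT (EFin \o (@rnorm R k \o f)) (cst 0%E).
  apply/(ae_eq_integral_abs mu measurableT (measurable_rnorm f1 f2)).
  rewrite -f0; apply: eq_integral => x _ /=.
  by rewrite ger0_norm// rnorm_ge0.
move=> ff; rewrite -[0 in RHS](_ : \pi_L1 0 = 0); last exact: pi_zeror.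
apply/eqP/eq_L1P; move: ff; apply: filterS => x /(_ I) /= [] /rnorm_eq0 -> //.
Qed.

HB.instance Definition _ :=
  Lmodule_isNormed.Build K L1 L1normD L1normZ L1norm0_eq0.

Lemma L1_norm_pi (f : L1fun) : `|\pi_L1 f : L1| = of_real k (fine (absint f)).
Proof. exact: L1norm_pi. Qed.

Definition mk_scalar : R -> R -> K :=
  match k with RealScalars => fun a _ => a | ComplexScalars => @Complex R end.

Lemma re_mk a b : re_part (mk_scalar a b) = a.
Proof. by rewrite /re_part /mk_scalar; destruct k. Qed.

Lemma rnorm_mk (z : K) a b : rnorm (z - mk_scalar a b) <= `|re_part z - a| + `|im_part z - b|.
Proof.
rewrite rnormE -(ler_pXn2r (ltn0Sn 1)) ?nnegrE ?sqrtr_ge0 ?addr_ge0//.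
rewrite sqr_sqrtr ?addr_ge0 ?sqr_ge0// sqrrD !real_normK ?num_real//.
have -> : re_part (z - mk_scalar a b) = re_part z - a.
  by rewrite /re_part /mk_scalar; destruct k => //=; case: z.
have : im_part (z - mk_scalar a b) ^+ 2 <= (im_part z - b) ^+ 2.
  rewrite /im_part /mk_scalar; destruct k => //=; first by rewrite expr0n sqr_ge0.
  by case: z.
move=> h; rewrite addrAC (le_trans (lerD (lexx _) h))// ?real_normK ?num_real// lerDl.
by rewrite mulrn_wge0// mulr_ge0.
Qed.

Lemma im_mk_measurable (a b : T -> R) : measurable_fun setT b ->
  measurable_fun setT (fun x => im_part (mk_scalar (a x) (b x))).
Proof. by rewrite /im_part /mk_scalar; destruct k. Qed.

Lemma re_part_le (z : K) : `|re_part z| <= rnorm z.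
Proof.
rewrite rnormE -sqrtr_sqr ler_wsqrtr// lerDl sqr_ge0//.
Qed.

Lemma im_part_le (z : K) : `|im_part z| <= rnorm z.
Proof.
rewrite rnormE -sqrtr_sqr ler_wsqrtr// lerDr sqr_ge0//.
Qed.

Lemma re_partB (x y : K) : re_part (x - y) = re_part x - re_part y.
Proof.
have -> : re_part x = re_part (x - y) + re_part y by rewrite -re_partD subrK.
by rewrite addrK.
Qed.

Lemma im_partB (x y : K) : im_part (x - y) = im_part x - im_part y.
Proof.
have -> : im_part x = im_part (x - y) + im_part y by rewrite -im_partD subrK.
by rewrite addrK.
Qed.


Lemma riesz_fischer (f : nat -> L1fun) :
  (forall i, (absint (f i - f i.+1)%R <= (1 / (2 ^ i.+1)%:R)%:E)%E) ->
  exists fl : L1fun, forall n, (absint (f n - fl)%R <= (1 / (2 ^ n)%:R)%:E)%E.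
Proof.
move=> fd.
pose r i (x : T) : R := rnorm (f i x - f i.+1 x).
have r_ge0 i x : 0 <= r i x by exact: rnorm_ge0.
have mr i : measurable_fun setT (EFin \o r i).
  have [m1 m2 _] := L1funP (f i - f i.+1).
  exact: (measurable_rnorm m1 m2).
pose h n (x : T) : \bar R := (\sum_(j <oo) (r (j + n)%N x)%:E)%E.
have h_ge0 n x : (0 <= h n x)%E.
  by apply: nneseries_ge0 => j _ _; rewrite lee_fin.
have mh n : measurable_fun setT (h n).
  apply: (@ge0_emeasurable_sum _ _ _ setT (fun j x => (r (j + n)%N x)%:E) xpredT) => //.
  - by move=> j x _ _; rewrite lee_fin.
  - by move=> j _; exact: mr.
have inth n : (\int[mu]_x h n x <= (1 / (2 ^ n)%:R)%:E)%E.
  rewrite integral_nneseries//.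
  - apply: le_trans (@epsilon_trick0 R (1 / (2 ^ n)%:R) xpredT _) => //.
    apply: lee_nneseries => [j _ _|j _].
      by apply: integral_ge0 => x _; rewrite lee_fin.
    apply: le_trans (fd (j + n)%N) _; rewrite lee_fin.
    by rewrite -addSn addnC expnD natrM invfM mulrA.
  - by move=> j; exact: mr.
  - by move=> j x _; rewrite lee_fin.
have h_sum n j x : ((\sum_(0 <= i < j) r (i + n)%N x)%:E <= h n x)%E.
  rewrite -sumEFin; apply: (@nneseries_lim_ge R (fun i => (r (i + n)%N x)%:E) xpredT).
  by move=> i _ _; rewrite lee_fin.
have h0n n x : (h n x < +oo)%E -> (h 0%N x < +oo)%E.
  have -> : h 0%N x = (\sum_(0 <= i < n) (r i x)%:E + h n x)%E.
    rewrite /h [LHS](@eq_eseriesr _ _ (fun i => (r i x)%:E)); last by move=> i _; rewrite addn0.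
    rewrite [LHS](@nneseries_split R _ 0 n); last by move=> i _; rewrite lee_fin.
    rewrite add0n -(@nneseries_addn R (fun i => (r i x)%:E))//.
    by move=> i; rewrite lee_fin.
  by move=> hn; rewrite lte_add_pinfty// sumEFin ltry.
have dist n j x : rnorm (f n x - f (j + n)%N x) <= \sum_(0 <= i < j) r (i + n)%N x.
  elim: j => [|j IH]; first by rewrite big_nil add0n subrr rnorm0.
  rewrite big_nat_recr//= addSn.
  rewrite -[f n x](subrK (f (j + n)%N x)) -addrA (le_trans (rnormD _ _))//.
  exact: lerD.
pose A := [set x | (h 0%N x < +oo)%E].
have mA : measurable A.
  by rewrite -[A]setTI; exact: (measurable_lte measurableT (mh 0%N) (measurable_cst _)).
have cvgA (p : K -> R) : (forall y z, p (y - z) = p y - p z) ->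
    (forall z, `|p z| <= rnorm z) -> forall x, A x -> cvgn (fun n => p (f n x)).
  move=> pB ple x Ax; pose u n := p (f n x).
  have cr : cvgn (series (r^~ x)).
    apply: nondecreasing_is_cvgn.
      by apply: nondecreasing_series => i _ _; exact: r_ge0.
    exists (fine (h 0%N x)) => _ [n _ <-].
    rewrite -lee_fin fineK ?ge0_fin_numE// seriesEnat/=.
    apply: le_trans (h_sum 0%N n x); rewrite lee_fin.
    by under [leRHS]eq_bigr do rewrite addn0.
  have : cvgn (series (telescope u)).
    apply: normed_cvg; apply: (series_le_cvg _ _ _ cr) => // n.
      exact: normr_ge0.
    by rewrite /telescope /= distrC /u -pB; exact: ple.
  rewrite telescopeK => cu.
  have -> : (fun n => p (f n x)) = (fun n => (u n - u 0%N) + u 0%N).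
    by apply/funext => n; rewrite subrK.
  by apply: is_cvgD => //; exact: is_cvg_cst.
pose a n := ((@re_part R k \o f n) \_ A : T -> R).
pose b n := ((@im_part R k \o f n) \_ A : T -> R).
have ma n : measurable_fun setT (a n).
  apply/(measurable_restrictT _ mA).1; apply: measurable_funTS.
  by case: (L1funP (f n)).
have mb n : measurable_fun setT (b n).
  apply/(measurable_restrictT _ mA).1; apply: measurable_funTS.
  by case: (L1funP (f n)).
pose al x := limn (a^~ x); pose bl x := limn (b^~ x).
have aE x n : A x -> a n x = re_part (f n x).
  by move=> Ax; rewrite /a patchE mem_set.
have bE x n : A x -> b n x = im_part (f n x).
  by move=> Ax; rewrite /b patchE mem_set.
have acv x : a^~ x @ \oo --> al x.
  have [Ax|nAx] := pselect (A x).
    rewrite /al (_ : a^~ x = fun n => re_part (f n x)); last first.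
      by apply/funext => n; rewrite aE.
    exact: (cvgA (@re_part R k) re_partB re_part_le).
  rewrite /al (_ : a^~ x = cst 0); first exact: is_cvg_cst.
  by apply/funext => n; rewrite /a patchE memNset.
have bcv x : b^~ x @ \oo --> bl x.
  have [Ax|nAx] := pselect (A x).
    rewrite /bl (_ : b^~ x = fun n => im_part (f n x)); last first.
      by apply/funext => n; rewrite bE.
    exact: (cvgA (@im_part R k) im_partB im_part_le).
  rewrite /bl (_ : b^~ x = cst 0); first exact: is_cvg_cst.
  by apply/funext => n; rewrite /b patchE memNset.
have mal : measurable_fun setT al by apply: (measurable_fun_cvg ma) => x _.
have mbl : measurable_fun setT bl by apply: (measurable_fun_cvg mb) => x _.
pose fl0 x : K := mk_scalar (al x) (bl x).
have key n x : ((rnorm (f n x - fl0 x))%:E <= h n x)%E.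
  have [hn|] := ltP (h n x) +oo%E; last by rewrite leye_eq => /eqP ->; rewrite leey.
  have Ax : A x by exact: h0n hn.
  rewrite -(fineK (_ : h n x \is a fin_num)) ?ge0_fin_numE// lee_fin.
  apply/ler_addgt0Pr => e e0.
  have e2 : 0 < e / 2 by rewrite divr_gt0.
  have := acv x => /cvgrPdist_lt /(_ _ e2) ha.
  have := bcv x => /cvgrPdist_lt /(_ _ e2) hb.
  near \oo => m.
  have nm : (n <= m)%N by near: m; exact: nbhs_infty_ge.
  rewrite -[f n x](subrK (f m x)) -addrA (le_trans (rnormD _ _))// lerD//.
    rewrite -lee_fin fineK ?ge0_fin_numE//; apply: le_trans (h_sum n (m - n)%N x).
    by rewrite lee_fin (le_trans _ (dist n (m - n)%N x))// subnK.
  rewrite (le_trans (rnorm_mk _ _ _))// [leRHS]splitr lerD//.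
  - by rewrite -aE// distrC ltW//; near: m.
  - by rewrite -bE// distrC ltW//; near: m.
have [m1 m2 m3] := L1funP (f 0%N).
have Ifl : integrable_fun fl0.
  split.
  - by rewrite (_ : _ \o _ = al)//; apply/funext => x /=; rewrite re_mk.
  - exact: im_mk_measurable.
  - apply: (@le_lt_trans _ _ (absint (f 0%N) + \int[mu]_x h 0%N x)%E).
      rewrite /absint -ge0_integralD//; first last.
      + exact: measurable_rnorm.
      + by move=> x _; rewrite lee_fin rnorm_ge0.
      apply: ge0_le_integral => //.
      + by move=> x _; rewrite lee_fin rnorm_ge0.
      + apply: (@measurable_rnorm fl0); last exact: im_mk_measurable.
        by rewrite (_ : _ \o _ = al)//; apply/funext => x /=; rewrite re_mk.
      + by apply: emeasurable_funD => //; exact: measurable_rnorm.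
      + move=> x _; apply: le_trans (leeD2l _ (key 0%N x)).
        rewrite -EFinD lee_fin -[fl0 x in leLHS](subKr (f 0%N x)).
        by rewrite (le_trans (rnormD _ _))// lerD// /rnorm normrN.
    apply: lte_add_pinfty => //.
    by apply: le_lt_trans (inth 0%N) _; rewrite ltry.
have Pfl : fl0 \in L1pred by exact/asboolP.
exists (MkL1fun Pfl) => n.
apply: le_trans (inth n).
have [k1 k2 _] := L1funP (f n - MkL1fun Pfl).
apply: ge0_le_integral => //.
- by move=> x _; rewrite lee_fin rnorm_ge0.
- exact: (measurable_rnorm k1 k2).
- by move=> x _; exact: key.
Unshelve. all: by end_near. Qed.

Lemma L1_complete (F : set_system L1) : ProperFilter F -> cauchy F -> cvg F.
Proof.
move=> FF /cauchyP Fc.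
have gt0 n : 0 < of_real k (1 / (2 ^ n.+2)%:R : R).
  by rewrite -(of_real0 R k) ltr_of_real divr_gt0// ltr0n expn_gt0.
have /choice[g gP] : forall n, exists x, F (ball x (of_real k (1 / (2 ^ n.+2)%:R : R))).
  by move=> n; exact: Fc.
pose f n : L1fun := repr (g n).
have gE n : g n = \pi_L1 (f n) by rewrite reprK.
have distE (f1 f2 : L1fun) : `|\pi_L1 f1 - \pi_L1 f2 : L1| = of_real k (fine (absint (f1 - f2)%R)).
  by rewrite -L1pi_opp -L1pi_add L1_norm_pi.
have [fl flP] : exists fl : L1fun, forall n, (absint (f n - fl)%R <= (1 / (2 ^ n)%:R)%:E)%E.
  apply: riesz_fischer => n.
  have [y []] := filter_ex (filterI (gP n) (gP n.+1)).
  rewrite -ball_normE /ball_/= => b1 b2.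
  have : `|g n - g n.+1| < of_real k (1 / (2 ^ n.+1)%:R).
    rewrite -[g n](subrK y) -addrA (le_lt_trans (ler_normD _ _))//.
    apply: lt_le_trans (ltrD b1 _) _.
      by rewrite distrC; exact: b2.
    rewrite -of_realD ler_of_real !(expnS 2) !natrM !invfM.
    have : 0 <= (2 ^ n)%:R^-1 :> R by rewrite invr_ge0.
    lra.
  rewrite !gE distE ltr_of_real => /ltW; rewrite -lee_fin fineK//.
  exact: absint_fin_num.
apply/cvg_ex; exists (\pi_L1 fl : L1); apply/cvgrPdist_lt => e e0.
have eE : of_real k (rnorm e) = e by rewrite of_real_rnorm gtr0_norm.
have re0 : 0 < rnorm e by rewrite -(ltr_of_real k) eE of_real0.
have [n nP] : exists n, 1 / (2 ^ n)%:R + 1 / (2 ^ n.+2)%:R < rnorm e.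
  have re2 : 0 < rnorm e / 2 by rewrite divr_gt0.
  have [n _ /(_ n (leqnn n)) nP] := near_infty_natSinv_expn_lt (PosNum re2).
  exists n; rewrite [ltRHS]splitr ltrD//; first by rewrite natrX.
  apply: le_lt_trans nP; rewrite !(expnS 2) !natrM !invfM natrX.
  have : 0 <= (2 ^+ n)^-1 :> R by rewrite invr_ge0 exprn_ge0.
  set X := _^-1; rewrite -/X; lra.
apply: filterS (gP n) => y; rewrite -ball_normE /ball_/= => yn.
rewrite -[\pi_L1 fl](subrK (g n)) -addrA (le_lt_trans (ler_normD _ _))//.
rewrite -eE (lt_trans _ (_ : of_real k (1 / (2 ^ n)%:R + 1 / (2 ^ n.+2)%:R) < _)) ?ltr_of_real//.
rewrite of_realD ler_ltD// distrC gE distE ler_of_real -lee_fin fineK//.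
exact: absint_fin_num.
Qed.

HB.instance Definition _ := Uniform_isComplete.Build L1 L1_complete.

End L1.


Section BanachPairs.
Context (R : realType) (k : scalarKind).
Notation K := (scalarField R k).

(* Over [R[i]] the order is partial, but a set of norms consists of nonnegative
   reals, and its least upper bound for that order is the usual supremum; see
   [opnorm_supremums]. *)
Definition opnorm (X Y : normedModType K) (T : X -> Y) : K :=
  supremum 0 [set `|T x| | x in [set x : X | `|x| <= 1]].

Definition bounded_operator (X Y : normedModType K) (T : {linear X -> Y}) : Prop :=
  bounded_near T (nbhs (0 : X)).

Definition BPBZp (X Y : completeNormedModType K) : Prop :=
  forall eps : K, 0 < eps ->
  exists eta : K, 0 < eta /\
  forall (T : {linear X -> Y}) (y0 : {linear Y -> K^o}) (x0 : X),
    bounded_operator T -> opnorm T = 1 ->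
    continuous y0 -> opnorm y0 = 1 ->
    `|x0| = 1 ->
    1 - eta < `|y0 (T x0)| ->
    exists (S : {linear X -> Y}) (y1 : {linear Y -> K^o}) (x1 : X),
      [/\ bounded_operator S, continuous y1, opnorm y1 = 1 & `|x1| = 1] /\
      [/\ opnorm S = 1, `|y1 (S x1)| = 1, `|x1 - x0| < eps,
          opnorm (y1 \- y0) < eps & opnorm (S \- T) < eps].

Lemma opnorm_supremums (X Y : normedModType K) (T : {linear X -> Y}) :
  bounded_operator T ->
  supremums [set `|T x| | x in [set x : X | `|x| <= 1]] (opnorm T).
Proof.
move=> /linear_boundedP /pinfty_ex_gt0[M M0 TM].
set A := [set _ | _ in _].
have A0 : A 0 by exists 0; rewrite /= ?linear0 normr0// ler01.
have AM : ubound A M.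
  move=> _ [x /= x1 <-]; rewrite (le_trans (TM x))//.
  by rewrite -[leRHS]mulr1 ler_pM2l.
have rA (z : K) : 0 <= z -> of_real k (re_part z) = z.
  by move=> z0; rewrite -[in RHS](ger0_norm z0) -of_real_rnorm /rnorm ger0_norm.
have A_ge0 z : A z -> 0 <= z by move=> [x _ <-].
have ubP z : ubound A z -> 0 <= z by move=> /(_ _ A0).
pose B := @re_part R k @` A.
have hB : has_sup B.
  split; first by exists (re_part (0 : K)), 0.
  exists (re_part M) => _ [z Az <-].
  by rewrite -(ler_of_real k) !rA ?(ubP M)// ?A_ge0//; exact: AM.
have sA : supremums A (of_real k (sup B)).
  split.
    move=> z Az; rewrite -(rA z (A_ge0 _ Az)) ler_of_real.
    by apply: sup_upper_bound => //; exists z.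
  move=> z Uz; rewrite -(rA z (ubP _ Uz)) ler_of_real; apply: ge_sup.
    by case: hB.
  move=> _ [w Aw <-]; rewrite -(ler_of_real k) !rA ?(ubP z)// ?A_ge0//; exact: Uz.
rewrite /opnorm /supremum ifF; first exact: xgetI sA.
by apply/negbTE/set0P; exists 0.
Qed.

End BanachPairs.

(* Main.v *)
From HB Require Import structures.
Require Import Defs.
From mathcomp Require Import all_boot all_order all_algebra.
From mathcomp Require Import lra ring.
From mathcomp Require Import all_classical all_reals all_analysis measurable_realfun.

(** Multiplying by unimodular functions on both sides reduces to [x0 >= 0] and
   [T x0 >= 0].  A Hahn decomposition yields [G] carrying most of [T x0] on which [y0]
   is close to the integral; a second one, for [u |-> \int_G T u], yields [C] carrying
   most of [x0] on which [\int_G T u] is close to [\int u] for [u >= 0].  Hence [1_G T]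
   is close to its modulus [|1_G T|] on [L1(C)].  The modulus is the strong limit of
   [u |-> \sum_i sigma_i T (1_{E_i} u)], where the finite partitions [(E_i)] nearly
   maximise [\sum_i `|T (1_{E_i} x0)|] and [sigma_i] is the conjugate phase of
   [T (1_{E_i} x0)].  Adding a small positive rank-one operator makes it preserve
   integrals, so that it attains its norm at [1_C x0] and is detected by [\int_G]. *)

Set Implicit Arguments.
Unset Strict Implicit.
Unset Printing Implicit Defensive.

Import Order.TTheory GRing.Theory Num.Theory.

Local Open Scope classical_set_scope.
Local Open Scope ring_scope.
Local Open Scope quotient_scope.

(** * Scalars over both fields: coordinates, phases, and distance to the nonnegative reals *)

Section Scalars.
Context (R : realType) (k : scalarKind).
Notation K := (scalarField R k).

(** The measures are arbitrary, so the dual of [L_1] need not be a space of functions and operators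
    need not have kernels. Densities are avoided by anchoring every construction at one vector, [x0]
    or [T x0]: its restrictions to measurable sets define finite charges, and they generate, by
    sums, nonnegative multiples and limits, the positive functions on the chosen set. The detour
    through the modulus has a reason: [1_G T] sends positive functions on [C] only to nearly
    positive ones, whereas topping up the lost integral keeps the norm equal to 1 when the operator
    is truly positive there. Norm bounds need only be checked on positive functions: every [u]
    splits into cells of nearly constant phase without loss of norm, so the constant does not change
    and an exact norm 1 survives. Constants: a real part within a fraction [b = a^2 / 2] of the norm
    gives a distance of at most a fraction [a], and each of the two Hahn steps divides the loss by
    [b], whence [eta = a b^2 / 2]. *)

Lemma scalarP (x y : K) : re_part x = re_part y -> im_part x = im_part y -> x = y.
Proof.
rewrite /re_part /im_part; destruct k => //=.
by case: x => a b; case: y => c e /= -> ->.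
Qed.

Lemma im_part_of_real (a : R) : im_part (of_real k a) = 0.
Proof. by rewrite /of_real /im_part; destruct k. Qed.

Lemma of_realB (x y : R) : of_real k (x - y) = of_real k x - of_real k y.
Proof. by apply/eqP; rewrite eq_sym subr_eq -of_realD subrK. Qed.

Lemma rnorm_of_real (a : R) : rnorm (of_real k a) = `|a|.
Proof. by rewrite rnormE re_part_of_real im_part_of_real expr0n addr0 sqrtr_sqr. Qed.

Lemma of_real1 : of_real k (1 : R) = 1.
Proof. by rewrite /of_real; destruct k. Qed.

Lemma re_part0 : re_part (0 : K) = 0.
Proof. by rewrite -(of_real0 R k) re_part_of_real. Qed.

Lemma im_part0 : im_part (0 : K) = 0.
Proof. by rewrite -(of_real0 R k) im_part_of_real. Qed.

Lemma rnorm1 : rnorm (1 : K) = 1.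
Proof. by rewrite -of_real1 rnorm_of_real normr1. Qed.

Lemma rnorm_leD (z : K) : rnorm z <= `|re_part z| + `|im_part z|.
Proof. by have := rnorm_mk z 0 0; rewrite /mk_scalar; destruct k; rewrite !subr0. Qed.

(* The conjugate phase of [z], set to [1] at [z = 0] so that it is always unimodular. *)
Definition csgn (z : K) : K :=
  if rnorm z == 0 then 1
  else mk_scalar k (re_part z / rnorm z) (- im_part z / rnorm z).

Lemma sqr_rnorm (z : K) : rnorm z ^+ 2 = re_part z ^+ 2 + im_part z ^+ 2.
Proof. by rewrite rnormE sqr_sqrtr// addr_ge0// sqr_ge0. Qed.

Lemma re_csgn z : re_part (csgn z) = if rnorm z == 0 then 1 else re_part z / rnorm z.
Proof.
rewrite /csgn; case: ifP => _; last by rewrite re_mk.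
by rewrite -of_real1 re_part_of_real.
Qed.

Lemma im_csgn z : im_part (csgn z) = if rnorm z == 0 then 0 else - im_part z / rnorm z.
Proof.
rewrite /csgn; case: ifP => _; first by rewrite -of_real1 im_part_of_real.
by rewrite /mk_scalar /im_part; destruct k => //; rewrite oppr0 mul0r.
Qed.

Lemma csgnM z : csgn z * z = of_real k (rnorm z).
Proof.
have [/eqP z0|z0] := boolP (rnorm z == 0).
  by rewrite (rnorm_eq0 z0) mulr0 rnorm0 of_real0.
have h := sqr_rnorm z.
apply: scalarP; rewrite ?re_partM ?im_partM re_csgn im_csgn (negbTE z0).
  rewrite re_part_of_real; apply: (mulfI z0); rewrite -expr2 h.
  by field.
by rewrite im_part_of_real; field.
Qed.

Lemma rnorm_csgn z : rnorm (csgn z) = 1.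
Proof.
have [/eqP z0|z0] := boolP (rnorm z == 0).
  by rewrite /csgn z0 eqxx rnorm1.
apply: (mulIf z0); rewrite -rnormM csgnM rnorm_of_real mul1r ger0_norm//.
exact: rnorm_ge0.
Qed.

Lemma csgn_unit z : csgn z != 0.
Proof.
by apply: contra_eq_neq (rnorm_csgn z) => ->; rewrite rnorm0 eq_sym oner_eq0.
Qed.

Lemma rnormV (z : K) : rnorm (z^-1) = (rnorm z)^-1.
Proof.
have [->|z0] := eqVneq z 0; first by rewrite invr0 rnorm0 invr0.
have rz : rnorm z != 0 by apply: contra_neq z0; exact: rnorm_eq0.
by apply: (mulIf rz); rewrite -rnormM mulVf// mulVf// rnorm1.
Qed.

(** Conjugation in coordinates, valid for both fields. The squared distance from [z^-1] to the
    conjugate of [z] expands to [1 + 1 - 2 re (z z^-1) = 0]. *)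
Lemma unimodularV (z : K) : rnorm z = 1 ->
  re_part z^-1 = re_part z /\ im_part z^-1 = - im_part z.
Proof.
move=> z1; have := sqr_rnorm z; rewrite z1 => h1.
have := sqr_rnorm z^-1; rewrite rnormV z1 invr1 => h2.
have z0 : z != 0 by apply: contra_eq_neq z1 => ->; rewrite rnorm0 eq_sym oner_eq0.
have /(congr1 (@re_part R k)) : z * z^-1 = 1 by rewrite mulfV.
rewrite re_partM -of_real1 re_part_of_real => h3.
have /eqP : (re_part z^-1 - re_part z) ^+ 2 + (im_part z^-1 + im_part z) ^+ 2 = 0.
  by rewrite sqrrB sqrrD; lra.
rewrite paddr_eq0 ?sqr_ge0// !sqrf_eq0 subr_eq0 addr_eq0.
by case/andP => /eqP -> /eqP ->.
Qed.

(* [|z - r|^2 = 2 r (r - re z)] for [r = |z|], and AM-GM. *)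
Lemma rnorm_sub_modulus (z : K) (t : R) : 0 < t ->
  rnorm (z - of_real k (rnorm z)) <= (rnorm z - re_part z) / t + t * rnorm z.
Proof.
move=> t0; set r := rnorm z.
have r0 : 0 <= r := rnorm_ge0 z.
have rez : re_part z <= r by apply: le_trans (re_part_le z); exact: ler_norm.
have h := sqr_rnorm z; rewrite -/r in h.
have w : rnorm (z - of_real k r) ^+ 2 = 2 * r * (r - re_part z).
  rewrite sqr_rnorm re_partB im_partB re_part_of_real im_part_of_real subr0.
  rewrite sqrrB; nra.
have y0 : 0 <= (r - re_part z) / t by rewrite divr_ge0 ?subr_ge0// ltW.
have x0 : 0 <= t * r by rewrite mulr_ge0// ltW.
have xy : (r - re_part z) / t * (t * r) = r * (r - re_part z).
  by field; rewrite gt_eqF.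
rewrite -(ler_pXn2r (ltn0Sn 1)) ?nnegrE ?addr_ge0 ?rnorm_ge0// w.
move: y0 x0 xy; set y := _ / t; set x := t * r => *; nra.
Qed.

(** Expanding, [|w - n|^2 = |w|^2 - 2 n re w + n^2 <= 2 n^2 - 2 n^2 (1 - a^2/2) = a^2 n^2]. This is
    the origin of [b = a^2 / 2] in the positive case. *)
Lemma rnorm_sub_of_real (w : K) (n a : R) : 0 <= n -> 0 <= a ->
  rnorm w <= n -> (1 - a ^+ 2 / 2) * n <= re_part w -> rnorm (w - of_real k n) <= a * n.
Proof.
move=> n0 a0 wn rew.
rewrite -(ler_pXn2r (ltn0Sn 1)) ?nnegrE ?mulr_ge0 ?rnorm_ge0//.
rewrite sqr_rnorm re_partB im_partB re_part_of_real im_part_of_real subr0.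
have h := sqr_rnorm w; have := rnorm_ge0 w => w0.
have : rnorm w ^+ 2 <= n ^+ 2 by rewrite ler_pXn2r.
nra.
Qed.

End Scalars.

(** * Real-valued norms *)

Section RealNorm.
Context (R : realType) (k : scalarKind).
Notation K := (scalarField R k).

(** Norms take values in [K], whose order is partial over the complex scalars. Estimates are made
    with this real value, where suprema and real arithmetic are available. *)
Definition rn (V : normedModType K) (v : V) : R := re_part `|v|.

Implicit Types V : normedModType K.

Lemma of_real_rn V (v : V) : of_real k (rn v) = `|v|.
Proof. by rewrite -[in RHS](normr_id v) -of_real_rnorm /rnorm normr_id. Qed.

Lemma rnK (z : K^o) : rn z = rnorm z. Proof. by []. Qed.

Lemma rn_ge0 V (v : V) : 0 <= rn v.
Proof. by rewrite -(ler_of_real k) of_real_rn of_real0. Qed.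

Lemma rn0 V : rn (0 : V) = 0.
Proof. by rewrite /rn normr0 re_part0. Qed.

Lemma rnD V (u v : V) : rn (u + v) <= rn u + rn v.
Proof. by rewrite -(ler_of_real k) of_realD !of_real_rn ler_normD. Qed.

Lemma rnN V (v : V) : rn (- v) = rn v.
Proof. by rewrite /rn normrN. Qed.

Lemma rnB V (u v : V) : rn (u - v) <= rn u + rn v.
Proof. by rewrite (le_trans (rnD _ _))// rnN. Qed.

Lemma rn_distC V (u v : V) : rn (u - v) = rn (v - u).
Proof. by rewrite -rnN opprB. Qed.

Lemma rnZ V (a : K) (v : V) : rn (a *: v) = rnorm a * rn v.
Proof.
have inj : injective (@of_real R k) by exact: can_inj (@re_part_of_real R k).
by apply: inj; rewrite of_realM of_real_rnorm !of_real_rn normrZ.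
Qed.

Lemma rn_triangle V (w u v : V) : rn (u - v) <= rn (u - w) + rn (w - v).
Proof. by have := rnD (u - w) (w - v); rewrite addrA subrK. Qed.

Lemma rn_triangle_le V (w u v : V) (a b : R) :
  rn (u - w) <= a -> rn (w - v) <= b -> rn (u - v) <= a + b.
Proof. by move=> ha hb; apply: le_trans (rn_triangle w u v) _; exact: lerD. Qed.

Lemma rn_le_subr V (u v : V) (a b : R) : rn v <= a -> rn (u - v) <= b -> rn u <= a + b.
Proof. by move=> ha hb; rewrite -[u](subrK v) addrC (le_trans (rnD _ _))// lerD. Qed.

Lemma rn_le_sub V (u v : V) : rn u <= rn v + rn (u - v).
Proof. by have := rnD v (u - v); rewrite addrC subrK. Qed.

Lemma rn_sum V (I : Type) (r : seq I) (P : pred I) (f : I -> V) :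
  rn (\sum_(i <- r | P i) f i) <= \sum_(i <- r | P i) rn (f i).
Proof.
elim/big_rec2: _ => [|i x y _ h]; first by rewrite rn0.
by rewrite (le_trans (rnD _ _))// lerD2l.
Qed.

Lemma rn_eq0 V (v : V) : rn v <= 0 -> v = 0.
Proof.
move=> v0; apply/normr0_eq0; rewrite -of_real_rn (_ : rn v = 0) ?of_real0//.
by apply/eqP; rewrite eq_le v0 rn_ge0.
Qed.

Lemma rn_small V (v : V) : (forall e, 0 < e -> rn v <= e) -> v = 0.
Proof. by move=> h; apply: rn_eq0; apply/ler_addgt0Pr => e /h; rewrite add0r. Qed.

End RealNorm.

(** * Multiplication operators, restrictions and finite partitions on [L_1] *)

Section Multiplication.
Context d (T : measurableType d) (R : realType) (k : scalarKind).
Variable mu : {measure set T -> \bar R}.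
Notation K := (scalarField R k).
Notation L1f := (L1fun k mu).
Notation L1m := (L1 k mu).
Implicit Types (b : T -> K) (f g : L1f) (u v : L1m) (E F : set T).

Lemma rn_pi f : rn (\pi_L1m f : L1m) = fine (absint mu f).
Proof. by rewrite /rn L1_norm_pi re_part_of_real. Qed.

Lemma eq_pi f g : (forall x, f x = g x) -> \pi_L1m f = \pi_L1m g.
Proof. by move=> fg; apply/eqP/eq_L1P; exact: nearW. Qed.

Definition multiplier b : Prop :=
  [/\ measurable_fun setT (@re_part R k \o b),
      measurable_fun setT (@im_part R k \o b) & forall x, rnorm (b x) <= 1].

Lemma multiplier_integrable b (f : T -> K) : multiplier b -> integrable_fun mu f ->
  integrable_fun mu (fun x => b x * f x).
Proof.
move=> [b1 b2 b3] [f1 f2 f3].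
have m1 : measurable_fun setT (@re_part R k \o (fun x => b x * f x)).
  rewrite (_ : _ \o _ = (fun x => re_part (b x) * re_part (f x) - im_part (b x) * im_part (f x))).
    by apply: measurable_funB; apply: measurable_funM.
  by apply/funext => x /=; rewrite re_partM.
have m2 : measurable_fun setT (@im_part R k \o (fun x => b x * f x)).
  rewrite (_ : _ \o _ = (fun x => re_part (b x) * im_part (f x) + im_part (b x) * re_part (f x))).
    by apply: measurable_funD; apply: measurable_funM.
  by apply/funext => x /=; rewrite im_partM.
split=> //; apply: le_lt_trans f3; apply: ge0_le_integral => //.
- by move=> x _; rewrite lee_fin rnorm_ge0.
- exact: (measurable_rnorm m1 m2).
- exact: (measurable_rnorm f1 f2).
- by move=> x _; rewrite lee_fin rnormM ler_piMl// rnorm_ge0.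
Qed.

(* The junk value [0] when [b] is not a multiplier makes [Mul b] a linear contraction
   for every [b]. *)
Definition mulfun b f : L1f :=
  if pselect (multiplier b) is left mb
  then @MkL1fun _ _ _ _ mu (fun x => b x * f x : K^o)
         (introT (asboolP _) (multiplier_integrable mb (L1funP f)))
  else 0.

Lemma mulfunE b f x : multiplier b -> mulfun b f x = b x * f x.
Proof. by move=> mb; rewrite /mulfun; case: pselect. Qed.

Definition Mul b u : L1m := \pi_L1m (mulfun b (repr u)).

Lemma repr_pi_ae f : {ae mu, forall x, repr (\pi_L1m f) x = f x}.
Proof. by apply/eq_L1P; rewrite reprK. Qed.

Lemma Mul_pi b f : Mul b (\pi_L1m f) = \pi_L1m (mulfun b f).
Proof.
have [mb|nb] := pselect (multiplier b); last first.
  by rewrite /Mul /mulfun; case: pselect.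
apply/eqP/eq_L1P; apply: filterS (repr_pi_ae f) => x fx.
by rewrite !mulfunE// fx.
Qed.

Lemma pi_scale (a : K) f : \pi_L1m (a *: f) = a *: (\pi_L1m f : L1m).
Proof. by rewrite [RHS]L1scale_pi. Qed.

Lemma Mul_is_linear b : linear (Mul b).
Proof.
have [mb|nb] := pselect (multiplier b); last first.
  have M0 u : Mul b u = 0.
    by rewrite /Mul /mulfun; case: pselect => // _; exact: pi_zeror.
  by move=> a u v; rewrite !M0 scaler0 addr0.
move=> a; elim/quotW => f; elim/quotW => g.
rewrite -pi_scale -L1pi_add !Mul_pi -pi_scale -L1pi_add; apply: eq_pi => x.
rewrite mulfunE//.
rewrite [RHS](_ : _ = a * mulfun b f x + mulfun b g x)// !mulfunE//.
rewrite [(a *: f + g) x](_ : _ = a * f x + g x)// mulrDr; congr (_ + _).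
by rewrite mulrCA.
Qed.

HB.instance Definition _ b := GRing.isLinear.Build K L1m L1m *:%R (Mul b) (Mul_is_linear b).

Lemma rn_Mul_le b u : rn (Mul b u) <= rn u.
Proof.
have [mb|nb] := pselect (multiplier b); last first.
  rewrite /Mul /mulfun; case: pselect => // _.
  by rewrite (_ : \pi_L1m 0 = 0) ?rn0 ?rn_ge0//; exact: pi_zeror.
elim/quotW: u => f; rewrite Mul_pi !rn_pi.
apply: fine_le; rewrite ?absint_fin_num//.
have [f1 f2 _] := L1funP f; have [m1 m2 _] := L1funP (mulfun b f).
apply: ge0_le_integral => //.
- by move=> x _; rewrite lee_fin rnorm_ge0.
- exact: (measurable_rnorm m1 m2).
- exact: (measurable_rnorm f1 f2).
- move=> x _; rewrite lee_fin mulfunE// rnormM ler_piMl ?rnorm_ge0//.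
  by case: mb.
Qed.

Lemma Mul_Mul b b' c u : multiplier b -> multiplier b' -> multiplier c ->
  (forall x, b x * b' x = c x) -> Mul b (Mul b' u) = Mul c u.
Proof.
move=> mb mb' mc bc; elim/quotW: u => f; rewrite (Mul_pi b') (Mul_pi b) (Mul_pi c); apply: eq_pi => x.
by rewrite !mulfunE// mulrA bc.
Qed.

Lemma multiplier1 : multiplier (fun=> 1).
Proof. by split; rewrite ?rnorm1//; exact: measurable_cst. Qed.

Lemma Mul1 u : Mul (fun=> 1) u = u.
Proof.
elim/quotW: u => f; rewrite Mul_pi; apply: eq_pi => x.
by rewrite mulfunE ?mul1r//; exact: multiplier1.
Qed.

Definition unimodular b := multiplier b /\ forall x, rnorm (b x) = 1.

Lemma unimodular1 : unimodular (fun=> 1).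
Proof. by split; [exact: multiplier1|move=> _; exact: rnorm1]. Qed.

Lemma unimodular_inv b : unimodular b -> unimodular (fun x => (b x)^-1).
Proof.
move=> [[b1 b2 _] b3]; split; last by move=> x; rewrite rnormV b3 invr1.
split.
- rewrite (_ : _ \o _ = @re_part R k \o b)//.
  by apply/funext => x /=; case: (unimodularV (b3 x)).
- rewrite (_ : _ \o _ = -%R \o (@im_part R k \o b)); first exact: measurableT_comp.
  by apply/funext => x /=; case: (unimodularV (b3 x)).
- by move=> x; rewrite rnormV b3 invr1.
Qed.

Lemma unimodular_neq0 b x : unimodular b -> b x != 0.
Proof. by case=> _ b1; apply: contra_eq_neq (b1 x) => ->; rewrite rnorm0 eq_sym oner_eq0. Qed.

Lemma MulK b u : unimodular b -> Mul (fun x => (b x)^-1) (Mul b u) = u.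
Proof.
move=> ub; rewrite (@Mul_Mul _ _ (fun=> 1)) ?Mul1//.
- by case: (unimodular_inv ub).
- by case: ub.
- exact: multiplier1.
- by move=> x; rewrite mulVf// unimodular_neq0.
Qed.

Lemma MulVK b u : unimodular b -> Mul b (Mul (fun x => (b x)^-1) u) = u.
Proof.
move=> ub; rewrite (@Mul_Mul _ _ (fun=> 1)) ?Mul1//.
- by case: ub.
- by case: (unimodular_inv ub).
- exact: multiplier1.
- by move=> x; rewrite mulfV// unimodular_neq0.
Qed.

Lemma rn_Mul b u : unimodular b -> rn (Mul b u) = rn u.
Proof.
move=> ub; apply/eqP; rewrite eq_le rn_Mul_le/=.
by rewrite -{1}(MulK u ub) rn_Mul_le.
Qed.

Definition phase (f : T -> K) x : K := csgn (f x).

Lemma unimodular_phase f : unimodular (phase f).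
Proof.
have [f1 f2 _] := L1funP f; split; last by move=> x; exact: rnorm_csgn.
have mr : measurable_fun setT (fun x => rnorm (f x)).
  by apply/measurable_EFinP; exact: (measurable_rnorm f1 f2).
have mr0 : measurable_fun setT (fun x => rnorm (f x) == 0).
  apply: (measurable_fun_bool true).
  rewrite (_ : _ @^-1` _ = (fun x => rnorm (f x)) @^-1` [set 0]); last first.
    by apply/seteqP; split => x /= /eqP.
  by apply: mr => //; exact: measurable_set1.
have mi : measurable_fun setT (fun x => (rnorm (f x))^-1).
  (* On nonnegative reals inversion is the power [-1], a measurable function; both vanish at 0. *)
  rewrite (_ : (fun x => _) = (fun x => rnorm (f x) `^ (-1))).
    exact: (measurableT_comp (measurable_powR _) mr).
  by apply/funext => x; rewrite powR_inv1// rnorm_ge0.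
split.
- rewrite (_ : _ \o _ = (fun x => if rnorm (f x) == 0 then 1 else re_part (f x) / rnorm (f x))).
    by apply: measurable_fun_ifT => //; exact: measurable_funM.
  by apply/funext => x /=; rewrite /phase re_csgn.
- rewrite (_ : _ \o _ = (fun x => if rnorm (f x) == 0 then 0 else - im_part (f x) / rnorm (f x))).
    apply: measurable_fun_ifT => //.
    by apply: measurable_funM => //; exact: measurableT_comp.
  by apply/funext => x /=; rewrite /phase im_csgn.
- by move=> x; rewrite rnorm_csgn.
Qed.

Definition res E := Mul (fun x => (x \in E)%:R).

HB.instance Definition _ E := GRing.isLinear.Build K L1m L1m *:%R (res E) (Mul_is_linear _).

Lemma multiplier_ind E : measurable E -> multiplier (fun x => (x \in E)%:R).
Proof.
move=> mE; split.
- rewrite (_ : _ \o _ = \1_E) //.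
  apply/funext => x /=; rewrite indicE; case: (x \in E) => /=.
    by rewrite mulr1n -of_real1 re_part_of_real.
  by rewrite mulr0n re_part0.
- rewrite (_ : _ \o _ = cst 0); first exact: measurable_cst.
  apply/funext => x /=; case: (x \in E) => /=.
    by rewrite mulr1n -of_real1 im_part_of_real.
  by rewrite mulr0n im_part0.
- by move=> x; case: (x \in E); rewrite ?rnorm1 ?rnorm0.
Qed.

Lemma res_res E F u : measurable E -> measurable F -> res E (res F u) = res (E `&` F) u.
Proof.
move=> mE mF; apply: Mul_Mul; try exact: multiplier_ind.
  by apply: multiplier_ind; exact: measurableI.
by move=> x; rewrite in_setI; case: (x \in E); case: (x \in F); rewrite ?mulr1 ?mulr0.
Qed.

Lemma res_comm E F u : measurable E -> measurable F -> res E (res F u) = res F (res E u).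
Proof. by move=> mE mF; rewrite !res_res// setIC. Qed.

Lemma Mul_res b E u : multiplier b -> measurable E -> Mul b (res E u) = res E (Mul b u).
Proof.
move=> mb mE; have mi := multiplier_ind mE.
elim/quotW: u => f; rewrite /res (Mul_pi (fun x => (x \in E)%:R)) !(Mul_pi b).
rewrite (Mul_pi (fun x => (x \in E)%:R)).
by apply: eq_pi => x; rewrite !mulfunE// mulrCA.
Qed.

Lemma res0 u : res set0 u = 0.
Proof.
elim/quotW: u => f; rewrite /res Mul_pi -[RHS](_ : \pi_L1m 0 = 0); last exact: pi_zeror.
by apply: eq_pi => x; rewrite mulfunE ?in_set0 ?mul0r//; exact: multiplier_ind.
Qed.

(** A finite measurable partition given by its colour map: common refinements are pairs of maps,
    sums over cells are sums over a finite type, and empty cells are harmless. *)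
Definition colouring (I : finType) (c : T -> I) := forall i, measurable (c @^-1` [set i]).

Lemma colouring_pair (I J : finType) (c : T -> I) (e : T -> J) :
  colouring c -> colouring e -> colouring (fun x => (c x, e x)).
Proof.
move=> mc me [i j]; rewrite (_ : _ @^-1` _ = (c @^-1` [set i]) `&` (e @^-1` [set j])).
  exact: measurableI.
by apply/seteqP; split => x /= [-> ->].
Qed.

Lemma colouring_set E : measurable E -> colouring (fun x => x \in E).
Proof.
move=> mE [].
  by rewrite (_ : _ @^-1` _ = E)//; apply/seteqP; split => x /=; [exact: set_mem|exact: mem_set].
rewrite (_ : _ @^-1` _ = ~` E); first exact: measurableC.
apply/seteqP; split => x /=; first by move=> h /mem_set; rewrite h.
by move=> h; rewrite memNset.
Qed.

Lemma colouring_sum (I : finType) (c : T -> I) u : colouring c ->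
  \sum_i res (c @^-1` [set i]) u = u.
Proof.
move=> mc; elim/quotW: u => f.
under eq_bigr do rewrite /res Mul_pi.
have -> : \sum_i \pi_L1m (mulfun (fun x => (x \in c @^-1` [set i])%:R) f) =
    \pi_L1m (\sum_i mulfun (fun x => (x \in c @^-1` [set i])%:R) f) :> L1m.
  elim: (index_enum I) => [|i s IH]; first by rewrite !big_nil -[LHS](_ : \pi_L1m 0 = 0)//; exact: pi_zeror.
  by rewrite !big_cons IH L1pi_add.
apply: eq_pi => x.
have -> : (\sum_i mulfun (fun x => (x \in c @^-1` [set i])%:R) f) x =
    \sum_i mulfun (fun x => (x \in c @^-1` [set i])%:R) f x.
  by elim: (index_enum I) => [|i s IH]; rewrite ?big_nil// !big_cons -IH.
rewrite (bigD1 (c x))//= big1 => [|i /negPf ni]; rewrite mulfunE; try exact: multiplier_ind.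
  by rewrite addr0 mem_set ?mul1r.
by rewrite memNset ?mul0r// => /= h; rewrite h eqxx in ni.
Qed.

(** The additivity special to [L_1]: estimates made cell by cell add up without loss. At each point
    exactly one restricted function survives. *)
Lemma colouring_rn (I : finType) (c : T -> I) u : colouring c ->
  \sum_i rn (res (c @^-1` [set i]) u) = rn u.
Proof.
move=> mc; have le1 : rn u <= \sum_i rn (res (c @^-1` [set i]) u).
  by rewrite -{1}(colouring_sum u mc) rn_sum.
apply/eqP; rewrite eq_le {}le1 andbT.
elim/quotW: u => f.
under eq_bigr do rewrite /res Mul_pi rn_pi.
rewrite rn_pi -lee_fin -sumEFin fineK ?absint_fin_num//.
under eq_bigr do rewrite fineK ?absint_fin_num//.
have [f1 f2 _] := L1funP f.
rewrite -ge0_integral_sum//; last first.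
- by move=> i x _; rewrite lee_fin rnorm_ge0.
- move=> i; have [m1 m2 _] := L1funP (mulfun (fun x => (x \in c @^-1` [set i])%:R) f).
  exact: (measurable_rnorm m1 m2).
apply: ge0_le_integral => //.
- by move=> x _; apply: sume_ge0 => i _; rewrite lee_fin rnorm_ge0.
- apply: emeasurable_sum => i.
  have [m1 m2 _] := L1funP (mulfun (fun x => (x \in c @^-1` [set i])%:R) f).
  exact: (measurable_rnorm m1 m2).
- exact: (measurable_rnorm f1 f2).
- move=> x _; rewrite (bigD1 (c x))//= big1 => [|i /negPf ni].
    by rewrite mulfunE ?adde0 ?mem_set ?mul1r//; exact: multiplier_ind.
  rewrite mulfunE; last exact: multiplier_ind.
  by rewrite memNset ?mul0r ?rnorm0// => /= h; rewrite h eqxx in ni.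
Qed.

Lemma colouring_res_pair (I J : finType) (c : T -> I) (e : T -> J) i j u :
  colouring c -> colouring e ->
  res ((fun x => (c x, e x)) @^-1` [set (i, j)]) u =
  res (c @^-1` [set i]) (res (e @^-1` [set j]) u).
Proof.
move=> mc me; rewrite res_res//; congr (res _ u).
by apply/seteqP; split => x /= [-> ->].
Qed.

Lemma res_split E u : measurable E -> res E u + res (~` E) u = u.
Proof.
move=> mE; rewrite -[RHS](colouring_sum u (colouring_set mE)) big_bool/=.
congr (res _ u + res _ u).
- by apply/seteqP; split => x /=; [exact: mem_set|exact: set_mem].
- apply/seteqP; split => x /=; first by move=> h; rewrite memNset.
  by move=> h /mem_set; rewrite h.
Qed.

Lemma rn_split E u : measurable E -> rn (res E u) + rn (res (~` E) u) = rn u.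
Proof.
move=> mE; rewrite -[RHS](colouring_rn u (colouring_set mE)) big_bool/=.
congr (rn (res _ u) + rn (res _ u)).
- by apply/seteqP; split => x /=; [exact: mem_set|exact: set_mem].
- apply/seteqP; split => x /=; first by move=> h; rewrite memNset.
  by move=> h /mem_set; rewrite h.
Qed.

Lemma resC_res E u : measurable E -> res (~` E) (res E u) = 0.
Proof. by move=> mE; rewrite res_res ?setICl ?res0//; exact: measurableC. Qed.

Lemma res_idem E u : measurable E -> res E (res E u) = res E u.
Proof. by move=> mE; rewrite res_res// setIid. Qed.

(** * The integral, the modulus of a function and the positive cone *)

Definition integral_fun f : K :=
  mk_scalar k (\int[mu]_x re_part (f x)) (\int[mu]_x im_part (f x)).

Lemma integrable_re f : mu.-integrable setT (EFin \o (fun x => re_part (f x))).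
Proof.
have [f1 f2 f3] := L1funP f; apply/integrableP; split; first exact/measurable_EFinP.
apply: le_lt_trans f3; apply: ge0_le_integral => //.
- by apply: measurableT_comp => //; exact/measurable_EFinP.
- exact: (measurable_rnorm f1 f2).
- by move=> x _; rewrite lee_fin re_part_le.
Qed.

Lemma integrable_im f : mu.-integrable setT (EFin \o (fun x => im_part (f x))).
Proof.
have [f1 f2 f3] := L1funP f; apply/integrableP; split; first exact/measurable_EFinP.
apply: le_lt_trans f3; apply: ge0_le_integral => //.
- by apply: measurableT_comp => //; exact/measurable_EFinP.
- exact: (measurable_rnorm f1 f2).
- by move=> x _; rewrite lee_fin im_part_le.
Qed.

Lemma integrable_rnorm f : mu.-integrable setT (EFin \o (fun x => rnorm (f x))).
Proof.
have [f1 f2 f3] := L1funP f; apply/integrableP; split.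
  exact: (measurable_rnorm f1 f2).
apply: le_lt_trans f3; apply: ge0_le_integral => //.
- by apply: measurableT_comp => //; exact: (measurable_rnorm f1 f2).
- exact: (measurable_rnorm f1 f2).
- by move=> x _; rewrite /= ger0_norm ?rnorm_ge0.
Qed.

Lemma re_integral_fun f : re_part (integral_fun f) = \int[mu]_x re_part (f x).
Proof. by rewrite /integral_fun re_mk. Qed.

Lemma im_integral_fun f : im_part (integral_fun f) = \int[mu]_x im_part (f x).
Proof.
rewrite /integral_fun /mk_scalar /im_part; destruct k => //=.
by rewrite /Rintegral integral0.
Qed.

Definition L1int u : K^o := integral_fun (repr u).

Lemma L1int_pi f : L1int (\pi_L1m f) = integral_fun f.
Proof.
rewrite /L1int /integral_fun /Rintegral; congr (mk_scalar k (fine _) (fine _)).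
- have [f1 _ _] := L1funP f; have [g1 _ _] := L1funP (repr (\pi_L1m f)).
  apply: ae_eq_integral => //; try exact/measurable_EFinP.
  by apply: filterS (repr_pi_ae f) => x -> .
- have [_ f1 _] := L1funP f; have [_ g1 _] := L1funP (repr (\pi_L1m f)).
  apply: ae_eq_integral => //; try exact/measurable_EFinP.
  by apply: filterS (repr_pi_ae f) => x -> .
Qed.

Lemma L1int_is_linear : linear L1int.
Proof.
move=> a; elim/quotW => f; elim/quotW => g.
rewrite -pi_scale -L1pi_add !L1int_pi.
have E x : (a *: f + g) x = a * f x + g x by [].
have iZ (c : R) (h : T -> R) : mu.-integrable setT (EFin \o h) ->
    mu.-integrable setT (EFin \o (fun x => c * h x)).
  by move=> ih; exact: (integrableZl measurableT c ih).
have iD (h1 h2 : T -> R) : mu.-integrable setT (EFin \o h1) ->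
    mu.-integrable setT (EFin \o h2) ->
    mu.-integrable setT (EFin \o (fun x => h1 x + h2 x)).
  by move=> i1 i2; exact: (integrableD measurableT i1 i2).
have [[[rf jf] rg] jg] := (integrable_re f, integrable_im f, integrable_re g, integrable_im g).
apply: scalarP.
- rewrite re_partD [a *: _](_ : _ = a * integral_fun f)// re_partM !re_integral_fun im_integral_fun.
  transitivity (\int[mu]_x ((re_part a * re_part (f x) + (- im_part a) * im_part (f x)) + re_part (g x))).
    by apply: eq_Rintegral => x _; rewrite E re_partD re_partM mulNr.
  by rewrite !RintegralD ?RintegralZl ?mulNr//; do ?[exact: iZ|apply: iD => //].
- rewrite im_partD [a *: _](_ : _ = a * integral_fun f)// im_partM !im_integral_fun re_integral_fun.
  transitivity (\int[mu]_x ((re_part a * im_part (f x) + im_part a * re_part (f x)) + im_part (g x))).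
    by apply: eq_Rintegral => x _; rewrite E im_partD im_partM.
  by rewrite !RintegralD ?RintegralZl//; do ?[exact: iZ|apply: iD => //].
Qed.

HB.instance Definition _ := GRing.isLinear.Build K L1m K^o *:%R L1int L1int_is_linear.

Lemma re_L1int_le u : re_part (L1int u) <= rn u.
Proof.
elim/quotW: u => f; rewrite L1int_pi re_integral_fun rn_pi.
rewrite -[leRHS]/(\int[mu]_x rnorm (f x)).
apply: le_Rintegral => //; [exact: integrable_re|exact: integrable_rnorm|].
by move=> x _; apply: le_trans (re_part_le _); exact: ler_norm.
Qed.

(** Rotating [u] by the conjugate phase of its integral makes the integral real and keeps the
    norm. *)
Lemma rn_L1int_le u : rn (L1int u) <= rn u.
Proof.
have := re_L1int_le (csgn (L1int u) *: u).
rewrite linearZ/= [csgn _ *: L1int u](_ : _ = csgn (L1int u) * L1int u)// csgnM re_part_of_real.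
by rewrite rnZ rnorm_csgn mul1r.
Qed.

Definition L1abs u : L1m := Mul (phase (repr u)) u.

Lemma L1abs_pi f : L1abs (\pi_L1m f) = \pi_L1m (mulfun (phase f) f).
Proof.
rewrite /L1abs Mul_pi; apply/eqP/eq_L1P; apply: filterS (repr_pi_ae f) => x fx.
by rewrite !mulfunE ?/phase ?fx//; case: (unimodular_phase f); case: (unimodular_phase (repr (\pi_L1m f))).
Qed.

Lemma phase_mulfun f x : mulfun (phase f) f x = of_real k (rnorm (f x)).
Proof. by rewrite mulfunE ?csgnM//; case: (unimodular_phase f). Qed.

Lemma rn_L1abs u : rn (L1abs u) = rn u.
Proof. by rewrite rn_Mul//; exact: unimodular_phase. Qed.

(* [u >= 0] almost everywhere, stated through the norm. *)
Definition pos u := L1int u = of_real k (rn u).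

Lemma L1int_L1abs u : L1int (L1abs u) = of_real k (rn u).
Proof.
elim/quotW: u => f; rewrite L1abs_pi L1int_pi rn_pi; apply: scalarP.
  rewrite re_part_of_real re_integral_fun; apply: eq_Rintegral => x _.
  by rewrite phase_mulfun re_part_of_real.
rewrite im_part_of_real im_integral_fun (@eq_Rintegral _ _ _ _ _ (cst 0)).
  by rewrite /Rintegral integral0.
by move=> x _; rewrite phase_mulfun im_part_of_real.
Qed.

Lemma pos_L1abs u : pos (L1abs u).
Proof. by rewrite /pos L1int_L1abs rn_L1abs. Qed.

(** The modulus of the integral is at most the norm, so a real part reaching the norm leaves no room
    for an imaginary part. Positivity becomes a single real inequality, stable under limits. *)
Lemma posE u : rn u <= re_part (L1int u) -> pos u.
Proof.
move=> h; have h1 := rn_L1int_le u; have h2 := re_L1int_le u.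
have h3 := sqr_rnorm (L1int u); rewrite -rnK in h3.
have r0 := rn_ge0 u.
have e : re_part (L1int u) = rn u by apply/eqP; rewrite eq_le h2.
apply: scalarP; rewrite ?re_part_of_real ?im_part_of_real//.
have : im_part (L1int u) ^+ 2 <= 0.
  have : rn (L1int u) ^+ 2 <= rn u ^+ 2 by rewrite ler_pXn2r// ?nnegrE rn_ge0.
  rewrite h3 e; lra.
by move=> h4; apply/eqP; rewrite -sqrf_eq0 eq_le h4 sqr_ge0.
Qed.

Lemma pos_re u : pos u -> re_part (L1int u) = rn u.
Proof. by move=> ->; rewrite re_part_of_real. Qed.

Lemma pos0 : pos 0.
Proof. by apply: posE; rewrite rn0 linear0 re_part0. Qed.

Lemma posD u v : pos u -> pos v -> pos (u + v).
Proof.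
move=> /pos_re pu /pos_re pv; apply: posE.
by rewrite linearD/= re_partD pu pv rnD.
Qed.

Lemma rn_posD u v : pos u -> pos v -> rn (u + v) = rn u + rn v.
Proof. by move=> pu pv; rewrite -(pos_re (posD pu pv)) linearD/= re_partD !pos_re. Qed.

Lemma posZ (a : R) u : 0 <= a -> pos u -> pos (of_real k a *: u).
Proof.
move=> a0 pu; rewrite /pos linearZ/= [_ *: _](_ : _ = of_real k a * L1int u)// pu.
by rewrite -of_realM rnZ rnorm_of_real ger0_norm.
Qed.

Lemma pos_sum (I : Type) (r : seq I) (P : pred I) (f : I -> L1m) :
  (forall i, P i -> pos (f i)) -> pos (\sum_(i <- r | P i) f i).
Proof. by move=> h; elim/big_rec: _ => [|i x Pi]; [exact: pos0|apply: posD; exact: h]. Qed.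

(** On [E] and on its complement the real part of the integral is at most the norm; equality of the
    sums forces equality in each. *)
Lemma pos_res E u : measurable E -> pos u -> pos (res E u).
Proof.
move=> mE /pos_re pu; apply: posE.
have := rn_split u mE; have := re_L1int_le (res (~` E) u).
have : re_part (L1int (res E u)) + re_part (L1int (res (~` E) u)) = rn u.
  by rewrite -re_partD -linearD/= res_split.
lra.
Qed.

Lemma pos_closed u : (forall e, 0 < e -> exists2 v, pos v & rn (u - v) <= e) -> pos u.
Proof.
move=> h; apply: posE; apply/ler_addgt0Pr => e e0.
have e2 : 0 < e / 2 by rewrite divr_gt0.
have [v /pos_re pv uv] := h _ e2.
have := rn_le_sub u v; have := re_L1int_le (v - u).
by rewrite linearB/= re_partB pv [rn (v - u)]rn_distC; lra.
Qed.

(** The bound [rnorm_sub_modulus] at [b x * f x], integrated: if a rotation of [u] has integral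
    almost equal to the norm, it is almost the modulus. The free [t] replaces a square root and
    keeps the bound linear, hence integrable and summable over cells. *)
Lemma rn_Mul_sub_L1abs b u (t : R) : 0 < t -> unimodular b ->
  rn (Mul b u - L1abs u) <= (rn u - re_part (L1int (Mul b u))) / t + t * rn u.
Proof.
move=> t0 [mb b1]; elim/quotW: u => f.
rewrite L1abs_pi Mul_pi -L1pi_opp -L1pi_add !rn_pi L1int_pi re_integral_fun.
set g := mulfun b f - _.
rewrite -/(Rintegral mu setT (fun x => rnorm (g x))) -/(Rintegral mu setT (fun x => rnorm (f x))).
have [rg rf] := (integrable_rnorm g, integrable_rnorm f).
have rb := integrable_re (mulfun b f).
have iB : mu.-integrable setT (EFin \o (fun x => rnorm (f x) - re_part (mulfun b f x))).
  exact: (integrableB measurableT rf rb).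
have iZ (c : R) (h : T -> R) : mu.-integrable setT (EFin \o h) ->
    mu.-integrable setT (EFin \o (fun x => c * h x)).
  by move=> ih; exact: (integrableZl measurableT c ih).
rewrite -RintegralB// [X in X + _]mulrC -!RintegralZl// -RintegralD//; do ?exact: iZ.
apply: le_Rintegral => //.
  exact: (integrableD measurableT (iZ _ _ iB) (iZ _ _ rf)).
move=> x _; rewrite [g x](_ : _ = mulfun b f x - mulfun (phase f) f x)//.
rewrite phase_mulfun mulfunE//.
have -> : rnorm (f x) = rnorm (b x * f x) by rewrite rnormM b1 mul1r.
by rewrite [_^-1 * _]mulrC; exact: rnorm_sub_modulus.
Qed.

(** Links [pos] to the pointwise meaning. With the constant multiplier 1 the defect in
    [rn_Mul_sub_L1abs] is zero, leaving [t * rn u] for every [t > 0]. *)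
Lemma pos_L1absE u : pos u -> L1abs u = u.
Proof.
move=> pu; apply/esym/eqP; rewrite -subr_eq0; apply/eqP.
apply: rn_small => e e0.
have r1 : 0 < rn u + 1 by rewrite ltr_wpDl// rn_ge0.
have t0 : 0 < e / (rn u + 1) by rewrite divr_gt0.
have := rn_Mul_sub_L1abs u t0 (@unimodular1); rewrite Mul1 pos_re// subrr mul0r add0r.
move/le_trans; apply; rewrite -mulrA ler_piMr ?(ltW e0)//.
by rewrite mulrC ler_pdivrMr// mul1r lerDl.
Qed.

End Multiplication.

(** * Cells of nearly constant phase, and reduction of norm bounds to positive functions *)

Section Estimates.
Context d (T : measurableType d) (R : realType) (k : scalarKind).
Variable mu : {measure set T -> \bar R}.
Notation K := (scalarField R k).
Notation L1f := (L1fun k mu).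
Notation L1m := (L1 k mu).
Implicit Types (b : T -> K) (f g : L1f) (u v : L1m) (E F : set T).

Lemma rn_pi_le (C : R) f g : (forall x, rnorm (f x) <= C * rnorm (g x)) ->
  rn (\pi_L1m f : L1m) <= C * rn (\pi_L1m g : L1m).
Proof.
move=> fg; rewrite !rn_pi.
rewrite -/(Rintegral mu setT (fun x => rnorm (f x))) -/(Rintegral mu setT (fun x => rnorm (g x))).
have [rf rg] := (integrable_rnorm f, integrable_rnorm g).
rewrite -RintegralZl//; apply: le_Rintegral => //.
exact: (integrableZl measurableT C rg).
Qed.

Lemma rn_Mul_sub_scale b E u (a : K) (C : R) : multiplier b -> measurable E ->
  (forall x, E x -> rnorm (b x - a) <= C) ->
  rn (Mul b (res E u) - a *: res E u) <= C * rn (res E u).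
Proof.
move=> mb mE bC; have mi := @multiplier_ind _ _ R k _ mE.
elim/quotW: u => f; rewrite /res (Mul_pi (fun x => (x \in E)%:R)) (Mul_pi b).
rewrite -pi_scale -L1pi_opp -L1pi_add; apply: rn_pi_le => x.
set g := mulfun _ f.
rewrite [X in rnorm X](_ : _ = mulfun b g x - a * g x)// mulfunE// -mulrBl rnormM.
rewrite /g mulfunE//; have [xE|xE] := boolP (x \in E); last first.
  by rewrite mul0r rnorm0 !mulr0.
by rewrite mul1r ler_wpM2r ?rnorm_ge0// bC//; exact: set_mem.
Qed.

(** The colour is the integer part of [(g x + 1) / e], which lies between 0 and [2 / e]. *)
Lemma fine_colouring (g : T -> R) (e : R) : 0 < e -> measurable_fun setT g ->
  (forall x, `|g x| <= 1) ->
  exists (I : finType) (c : T -> I), colouring c /\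
    forall x y, c x = c y -> `|g x - g y| <= e.
Proof.
move=> e0 mg g1.
pose h x := (g x + 1) / e.
have mh : measurable_fun setT h.
  by apply: measurable_funM => //; exact: measurable_funD.
have h0 x : 0 <= h x.
  by have := g1 x; rewrite ler_norml => /andP[h1 _]; rewrite divr_ge0 ?(ltW e0)//; lra.
pose N := Num.truncn (2 / e).
have hN x : (Num.truncn (h x) < N.+1)%N.
  rewrite ltnS; apply: le_truncn; rewrite ler_pM2r ?invr_gt0//.
  by have := g1 x; rewrite ler_norml => /andP[_ h1]; lra.
exists 'I_N.+1, (fun x => Ordinal (hN x)); split.
  move=> i; rewrite (_ : _ @^-1` _ = h @^-1` `[i%:R, i.+1%:R[%classic).
    by rewrite -[X in measurable X]setTI; exact: mh.
  apply/seteqP; split => x /=.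
    by move=> <- /=; rewrite in_itv/= truncn_itv.
  rewrite in_itv/= => /andP[ih hi]; apply: val_inj => /=.
  by apply/eqP; rewrite truncn_eq// ih.
move=> x y /(congr1 val)/= hxy.
have := truncn_itv (h0 x); have := truncn_itv (h0 y); rewrite hxy.
move=> /andP[y1 y2] /andP[x1 x2].
have : `|h x - h y| <= 1 by rewrite ler_norml -natr1 in x2 y2 *; apply/andP; split; lra.
rewrite /h -mulrBl normrM (gtr0_norm (_ : 0 < e^-1)) ?invr_gt0// ler_pdivrMr// mul1r.
by rewrite opprD addrACA subrr addr0.
Qed.

(** Here [u = s |u|] with [s] unimodular; the cells are those on which both coordinates of [s] vary
    by at most [e / 2], so that [s] may be frozen on each. *)
Lemma polar_cells u (e : R) : 0 < e ->
  exists (I : finType) (c : T -> I) (a : I -> K),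
  [/\ colouring c, forall i, rnorm (a i) = 1 &
   forall i, rn (res (c @^-1` [set i]) u - a i *: res (c @^-1` [set i]) (L1abs u)) <=
     e * rn (res (c @^-1` [set i]) u)].
Proof.
move=> e0; have up := unimodular_phase (repr u).
set s := fun x => (phase (repr u) x)^-1.
have us : unimodular s := unimodular_inv up.
have [[s1 s2 s3] s4] := us.
have e2 : 0 < e / 2 by rewrite divr_gt0.
have [I [c [mc cE]]] := fine_colouring e2 s1 (fun x => le_trans (re_part_le _) (s3 x)).
have [J [c' [mc' cE']]] := fine_colouring e2 s2 (fun x => le_trans (im_part_le _) (s3 x)).
pose cc x := (c x, c' x); have mcc : colouring cc by exact: colouring_pair.
pose a (ij : I * J) : K :=
  if pselect (exists x, cc x = ij) is left ex then s (projT1 (cid ex)) else 1.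
exists (prod I J), cc, a; split => //.
  by move=> ij; rewrite /a; case: pselect => [?|_]; rewrite ?s4// rnorm1.
move=> ij; set E := cc @^-1` [set ij].
have mE : measurable E by exact: mcc.
have -> : res E u = Mul s (res E (L1abs u)).
  by rewrite Mul_res ?MulK//; case: us.
rewrite (rn_Mul _ us); apply: rn_Mul_sub_scale; [by case: us|by []|].
move=> x Ex; rewrite /a; case: pselect => [ex|]; last by case; exists x.
case: (cid ex) => y /= yij.
have [] : cc x = cc y by rewrite yij; exact: Ex.
move=> /cE h1 /cE' h2.
rewrite (le_trans (rnorm_leD _))// re_partB im_partB [leRHS]splitr.
exact: lerD.
Qed.

(** On each cell of [polar_cells], [u] is a unimodular scalar times a positive function of the same
    norm, up to a small error. The crude bound [M] controls only the errors, so it disappears in the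
    limit. *)
Lemma bounded_on_pos (V : normedModType K) (Q : {linear L1m -> V}) (M C : R) :
  (forall u, rn (Q u) <= M * rn u) ->
  (forall u, pos u -> rn (Q u) <= C * rn u) ->
  forall u, rn (Q u) <= C * rn u.
Proof.
move=> QM QC u.
have M0 : forall u, 0 <= M * rn u by move=> w; apply: le_trans (QM w); exact: rn_ge0.
apply/ler_addgt0Pr => e e0.
have D0 : 0 < M * rn u + 1 by rewrite ltr_wpDl.
have [I [c [a [mc a1 ca]]]] := polar_cells u (divr_gt0 e0 D0).
set e' := e / _ in ca.
rewrite -{1}(colouring_sum u mc) linear_sum/= (le_trans (rn_sum _ _ _))//.
apply: (@le_trans _ _ (\sum_i (C + M * e') * rn (res (c @^-1` [set i]) u))).
  apply: ler_sum => i _; set w := res _ u; set w' := res (c @^-1` [set i]) (L1abs u).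
  have ww' : rn w' = rn w.
    have up := unimodular_phase (repr u).
    by rewrite /w' /L1abs -Mul_res ?(rn_Mul _ up)//; case: up.
  have -> : Q w = a i *: Q w' + Q (w - a i *: w').
    by rewrite linearB/= linearZ/= addrC subrK.
  rewrite (le_trans (rnD _ _))// rnZ a1 mul1r mulrDl lerD//.
    by rewrite -ww' QC//; apply: pos_res; [exact: mc|exact: pos_L1abs].
  rewrite (le_trans (QM _))//.
  have := ca i; rewrite -/w -/w' => cai.
  (* [0 <= M] follows only from a vector of nonzero norm; if [rn w = 0] the error term is itself
     zero. *)
  have [w0|w0] := eqVneq (rn w) 0.
    have -> : w - a i *: w' = 0.
      by apply: rn_eq0; rewrite (le_trans cai)// w0 mulr0.
    by rewrite rn0 w0 !mulr0.
  have M1 : 0 <= M.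
    have := M0 w; rewrite pmulr_lge0// lt_neqAle eq_sym w0; exact: rn_ge0.
  by rewrite -mulrA ler_wpM2l.
rewrite -mulr_sumr colouring_rn// mulrDl lerD2l mulrAC /e' mulrCA ler_piMr ?(ltW e0)//.
by rewrite ler_pdivrMr// mul1r lerDl.
Qed.

(** Dominated convergence with [|f|] as dominating function. It supplies both the exhaustion
    arguments and the countable additivity below. *)
Lemma res_cvg0 (F : nat -> set T) u : (forall n, measurable (F n)) ->
  (forall x, exists N, forall n, (N <= n)%N -> ~ F n x) ->
  forall e, 0 < e -> exists N, forall n, (N <= n)%N -> rn (res (F n) u) <= e.
Proof.
move=> mF Fx e e0; elim/quotW: u => f.
have [f1 f2 _] := L1funP f.
pose h n x := (rnorm (mulfun (fun x => (x \in F n)%:R) f x))%:E.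
have hE n x : h n x = ((x \in F n)%:R * rnorm (f x))%:E.
  rewrite /h mulfunE; last exact: multiplier_ind.
  by rewrite rnormM; case: (x \in F n); rewrite ?rnorm1 ?rnorm0.
have [_ _] : [/\ mu.-integrable setT (cst 0%E),
    (\int[mu]_x `|h n x - cst 0%E x|)%E @[n --> \oo] --> 0%E &
    (\int[mu]_x h n x)%E @[n --> \oo] --> (\int[mu]_x cst 0%E x)%E].
  apply: (@dominated_convergence _ _ _ mu setT measurableT h (cst 0%E)
    (fun x => (rnorm (f x))%:E)) => //.
  - move=> n; have [m1 m2 _] := L1funP (mulfun (fun x => (x \in F n)%:R) f).
    exact: (measurable_rnorm m1 m2).
  - apply: aeW => x _; have [N FN] := Fx x.
    apply: cvg_near_cst; exists N => // n /= Nn.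
    by rewrite hE memNset ?mul0r//; exact: FN.
  - exact: (integrable_rnorm f).
  - apply: aeW => x n _; rewrite hE abse_EFin lee_fin ger0_norm ?mulr_ge0 ?rnorm_ge0//.
    by rewrite ler_piMl ?rnorm_ge0//; case: (x \in F n).
rewrite integral0 => /fine_cvgP[_] /cvgrPdist_le /(_ e e0)[N _ NP].
exists N => n Nn; have := NP n Nn; rewrite /= sub0r normrN ger0_norm.
  by rewrite /res Mul_pi rn_pi.
by rewrite fine_ge0// integral_ge0// => x _; rewrite lee_fin rnorm_ge0.
Qed.

(** Taken on the chosen representative, so that division by its modulus is legitimate at every point
    of the set, without an exceptional null set. *)
Definition supp u := [set x | rnorm (repr u x) != 0].

Lemma measurable_supp u : measurable (supp u).
Proof.
have [f1 f2 _] := L1funP (repr u).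
have mr : measurable_fun setT (fun x => rnorm (repr u x)).
  by apply/measurable_EFinP; exact: (measurable_rnorm f1 f2).
rewrite (_ : supp u = (fun x => rnorm (repr u x)) @^-1` (~` [set 0])).
  by rewrite -[X in measurable X]setTI; apply: mr => //; apply: measurableC; exact: measurable_set1.
by apply/seteqP; split => x /= /eqP.
Qed.

Lemma res_supp u : res (supp u) u = u.
Proof.
rewrite -[in LHS](reprK u) -[RHS](reprK u) /res Mul_pi; apply: eq_pi => x.
rewrite mulfunE; last by apply: multiplier_ind; exact: measurable_supp.
have [_|xs] := boolP (x \in _); first by rewrite mul1r.
rewrite mul0r; apply/esym/rnorm_eq0/eqP; move: xs; apply: contraNT => h.
by rewrite mem_set// /supp /= reprK.
Qed.

End Estimates.

(** * An induction principle for positive functions carried by [C] *)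

Section Density.
Context d (T : measurableType d) (R : realType) (k : scalarKind).
Variable mu : {measure set T -> \bar R}.
Notation K := (scalarField R k).
Notation L1m := (L1 k mu).
Implicit Types (u v : L1m) (E F : set T).

Lemma multiplier_of_real (h : T -> R) : measurable_fun setT h ->
  (forall x, 0 <= h x <= 1) -> multiplier (fun x => of_real k (h x)).
Proof.
move=> mh h01; split.
- by rewrite (_ : _ \o _ = h)//; apply/funext => x /=; rewrite re_part_of_real.
- rewrite (_ : _ \o _ = cst 0); first exact: measurable_cst.
  by apply/funext => x /=; rewrite im_part_of_real.
- by move=> x; have /andP[h0 h1] := h01 x; rewrite rnorm_of_real ger0_norm.
Qed.

Variables (p : L1m) (C : set T) (W : L1m -> Prop).
Hypothesis mC : measurable C.
Hypothesis Cp : C `<=` supp p.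
Hypothesis WD : forall u v, W u -> W v -> W (u + v).
Hypothesis WZ : forall (a : R) u, 0 <= a -> W u -> W (of_real k a *: u).
Hypothesis Wcl : forall u, (forall e, 0 < e -> exists2 w, W w & rn (u - w) <= e) -> W u.
Hypothesis Wp : forall E, measurable E -> E `<=` C -> W (res E p).

(* Binary expansion of [h]: [h = 1_A / 2 + h' / 2] with [A = {h >= 1/2}] and [0 <= h' <= 1]. *)
Let dyadic n : forall h : T -> R, measurable_fun setT h ->
  (forall x, 0 <= h x <= 1) -> (forall x, ~ C x -> h x = 0) ->
  exists2 w, W w & rn (Mul (fun x => of_real k (h x)) p - w) <= (2 ^- n) * rn p.
Proof.
elim: n => [|n IH] h mh h01 hC.
  exists 0; first by rewrite -(res0 p); apply: Wp.
  by rewrite subr0 expr0 invr1 mul1r rn_Mul_le.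
pose A := [set x | 2^-1 <= h x].
have mA : measurable A.
  rewrite (_ : A = h @^-1` `[2^-1, +oo[%classic).
    by rewrite -[X in measurable X]setTI; exact: mh.
  by apply/seteqP; split => x /=; rewrite in_itv/= andbT.
have AC : A `<=` C.
  move=> x Ax; apply: contrapT => /hC hx; move: Ax; rewrite /A/= hx.
  by rewrite leNgt invr_gt0 ltr0n.
pose h' x := 2 * h x - \1_A x.
have mh' : measurable_fun setT h'.
  by apply: measurable_funB => //; exact: measurable_funM.
have h'01 x : 0 <= h' x <= 1.
  rewrite /h' indicE; have /andP[h0 h1] := h01 x.
  have [xA|xA] := boolP (x \in A).
    by have := set_mem xA; rewrite /A /=; lra.
  have : h x < 2^-1 by rewrite ltNge; apply: contra xA => xA; exact: mem_set.
  rewrite /=; lra.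
have h'C x : ~ C x -> h' x = 0.
  by move=> nC; rewrite /h' hC// mulr0 indicE memNset ?subr0// => /AC.
have [w Ww hw] := IH h' mh' h'01 h'C.
exists (of_real k 2^-1 *: (res A p + w)).
  by apply: WZ => //; apply: WD => //; exact: Wp.
have hE u : Mul (fun x => of_real k (h x)) u =
    of_real k 2^-1 *: (res A u + Mul (fun x => of_real k (h' x)) u).
  elim/quotW: u => f; rewrite /res !Mul_pi -L1pi_add -pi_scale; apply: eq_pi => x.
  rewrite mulfunE; last exact: multiplier_of_real.
  set g1 := mulfun _ f; set g2 := mulfun _ f.
  rewrite [RHS](_ : _ = of_real k 2^-1 * (g1 x + g2 x))// /g1 /g2.
  rewrite mulfunE; last exact: multiplier_ind.
  rewrite mulfunE; last exact: multiplier_of_real.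
  have -> : (x \in A)%:R = of_real k (\1_A x) :> K.
    by rewrite indicE; case: (x \in A); rewrite ?of_real0 ?of_real1.
  rewrite -mulrDl -of_realD mulrA -of_realM; congr (of_real _ _ * _).
  by rewrite /h'; lra.
rewrite hE -scalerBr opprD addrACA subrr add0r rnZ rnorm_of_real ger0_norm//.
by rewrite exprS invfM -mulrA ler_pM2l.
Qed.

(** Restrictions of [p] take the place of indicators, which may fail to be integrable. Since [p]
    does not vanish on [C], a positive [u] is a density times [p]; truncation makes the density
    bounded, and its binary expansion uses only restrictions of [p]. *)
Lemma pos_cone_dense u : pos p -> pos u -> res C u = u -> W u.
Proof.
move=> pp pu Cu; apply: Wcl => e e0.
have [q1 q2 _] := L1funP (repr p); have [f1 f2 _] := L1funP (repr u).
pose q x := rnorm (repr p x); pose f x := rnorm (repr u x).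
have mq : measurable_fun setT q by apply/measurable_EFinP; exact: (measurable_rnorm q1 q2).
have mf : measurable_fun setT f by apply/measurable_EFinP; exact: (measurable_rnorm f1 f2).
have q0 x : C x -> 0 < q x by move=> /Cp h; rewrite lt_neqAle rnorm_ge0 eq_sym andbT.
(* On [E n] the density [f / q] is at most [n + 1]; as [q > 0] on [C], these sets exhaust [C]. *)
pose E n := C `&` [set x | f x <= n.+1%:R * q x].
have mE n : measurable (E n).
  apply: measurableI => //; rewrite -[X in measurable X]setTI.
  apply: measurable_fun_le => //; exact: measurable_funM.
have Ex x : exists N, forall n, (N <= n)%N -> ~ (C `\` E n) x.
  have [Cx|nCx] := pselect (C x); last by exists 0%N => n _ [].
  exists (Num.truncn (f x / q x)) => n Nn [_]; apply; split => //=.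
  by rewrite -ler_pdivrMr ?q0// ltW// (lt_le_trans (truncnS_gt _))// ler_nat ltnS.
have [N /(_ _ (leqnn N)) NP] := res_cvg0 u (fun n => measurableD mC (mE n)) Ex e0.
exists (res (E N) u); last first.
  rewrite -[X in X - _](res_split u (mE N)) addrC addKr -Cu res_res//; last exact: measurableC.
  by rewrite setIC; exact: NP.
(* The truncated density of [u] with respect to [p], rescaled into [[0, 1]]. *)
pose h x := \1_(E N) x * (f x / (N.+1%:R * q x)).
have mh : measurable_fun setT h.
  apply: measurable_funM => //; apply: measurable_funM => //.
  rewrite (_ : (fun x => _) = (fun x => (N.+1%:R * q x) `^ (-1))).
    by apply: (measurableT_comp (measurable_powR _)); exact: measurable_funM.
  by apply/funext => x; rewrite powR_inv1// mulr_ge0// rnorm_ge0.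
have h01 x : 0 <= h x <= 1.
  rewrite /h indicE; have [xE|_] := boolP (x \in E N); last by rewrite mul0r lexx ler01.
  have [Cx /= fx] := set_mem xE; rewrite mul1r divr_ge0 ?mulr_ge0 ?rnorm_ge0//=.
  by rewrite ler_pdivrMr ?mul1r// mulr_gt0// q0.
have hC x : ~ C x -> h x = 0 by move=> nC; rewrite /h indicE memNset ?mul0r// => -[].
have -> : res (E N) u = of_real k N.+1%:R *: Mul (fun x => of_real k (h x)) p.
  (* Positivity replaces both functions by their moduli, which turns the identity into one between
     real numbers. *)
  rewrite -{1}(pos_L1absE pu) -{1}(pos_L1absE pp).
  rewrite -{1}[u]reprK -{1}[p]reprK !L1abs_pi /res !Mul_pi -pi_scale; apply: eq_pi => x.
  rewrite mulfunE; last exact: multiplier_ind.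
  set g := mulfun (fun x => of_real k (h x)) _.
  rewrite [RHS](_ : _ = of_real k N.+1%:R * g x)// /g.
  rewrite (mulfunE _ _ (multiplier_of_real mh h01)).
  rewrite !phase_mulfun -!of_realM.
  have -> : (x \in E N)%:R = of_real k (\1_(E N) x) :> K.
    by rewrite indicE; case: (x \in E N); rewrite ?of_real0 ?of_real1.
  rewrite -of_realM; congr (of_real _ _); rewrite /h indicE -/(f x) -/(q x).
  have [xE|_] := boolP (x \in E N); last by rewrite !mul0r mulr0.
  have [Cx _] := set_mem xE; have qx := q0 _ Cx.
  by field; rewrite gt_eqF// -?natr1; have : (0 : R) <= N%:R by []; lra.
apply: WZ => //; apply: Wcl => e' e'0.
have r1 : 0 < rn p + 1 by rewrite ltr_wpDl// rn_ge0.
have [n _ /(_ n (leqnn n)) nP] := near_infty_natSinv_expn_lt (PosNum (divr_gt0 e'0 r1)).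
have [w Ww hw] := dyadic n mh h01 hC.
exists w => //; apply: (le_trans hw).
apply: (@le_trans _ _ (e' / (rn p + 1) * rn p)).
  by rewrite ler_wpM2r ?rn_ge0//; move: nP; rewrite /= div1r; exact: ltW.
by rewrite mulrAC -mulrA ler_piMr ?(ltW e'0)// ler_pdivrMr// mul1r lerDl.
Qed.

End Density.

(** * The charge of a functional along a vector, and its Hahn decomposition *)

Section Hahn.
Context d (T : measurableType d) (R : realType) (k : scalarKind).
Variable mu : {measure set T -> \bar R}.
Notation K := (scalarField R k).
Notation L1m := (L1 k mu).
Implicit Types (u : L1m) (E F : set T).

Let setU_disjoint E F : E `&` F = set0 ->
  E `&` (E `|` F) = E /\ (~` E) `&` (E `|` F) = F.
Proof.
move=> EF; split; first by apply: setIidl; exact: subsetUl.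
rewrite setIUr setICl set0U setIidr// => x Fx Ex; have : (E `&` F) x by [].
by rewrite EF.
Qed.

Lemma resU E F u : measurable E -> measurable F -> E `&` F = set0 ->
  res (E `|` F) u = res E u + res F u.
Proof.
move=> mE mF /setU_disjoint[e1 e2]; have mU : measurable (E `|` F) by exact: measurableU.
by rewrite -[LHS](res_split _ mE) !res_res ?e1 ?e2//; exact: measurableC.
Qed.

Lemma rn_resU E F u : measurable E -> measurable F -> E `&` F = set0 ->
  rn (res (E `|` F) u) = rn (res E u) + rn (res F u).
Proof.
move=> mE mF /setU_disjoint[e1 e2]; have mU : measurable (E `|` F) by exact: measurableU.
by rewrite -(rn_split (res (E `|` F) u) mE) !res_res ?e1 ?e2//; exact: measurableC.
Qed.

Variables (phi : {linear L1m -> K^o}) (v : L1m) (b : R).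
Hypothesis phi_le : forall u, rn (phi u) <= rn u.

(** A Hahn set of this charge plays the role of the set where a bounded function representing [phi]
    would have real part at least [b] along [v], without any representation of the dual. *)
Definition defect E : R := re_part (phi (res E v)) - b * rn (res E v).

Lemma defectU E F : measurable E -> measurable F -> E `&` F = set0 ->
  defect (E `|` F) = defect E + defect F.
Proof.
move=> mE mF EF; rewrite /defect rn_resU// resU// linearD/= re_partD; lra.
Qed.

Lemma defect_le E : `|defect E| <= (1 + `|b|) * rn (res E v).
Proof.
rewrite (le_trans (ler_normB _ _))// mulrDl mul1r lerD//.
  by rewrite (le_trans (re_part_le _))//; exact: phi_le.
by rewrite normrM [`|rn _|]ger0_norm// rn_ge0.
Qed.

Definition edefect E : \bar R := (defect E)%:E.

Let edefect0 : edefect set0 = 0%E.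
Proof. by rewrite /edefect /defect res0 linear0 re_part0 rn0 mulr0 subr0. Qed.

Let edefect_fin E : measurable E -> edefect E \is a fin_num.
Proof. by []. Qed.

(** Given finite additivity, only the tails [D n] of the union matter. Each point eventually leaves
    them, so [res_cvg0] makes [v] small there, and [defect_le] transfers this to the charge. *)
Let edefect_sigma_additive : semi_sigma_additive edefect.
Proof.
move=> F mF tF mUF.
have sumE n : (\sum_(0 <= i < n) edefect (F i))%E = edefect (\big[setU/set0]_(i < n) F i).
  elim: n => [|n IH]; first by rewrite big_nil big_ord0 edefect0.
  rewrite big_nat_recr//= IH big_ord_recr/= /edefect -EFinD defectU//.
    by apply: bigsetU_measurable => i _.
  by apply: (@trivIset_bigsetUI _ xpredT) => // i j _ _; exact: tF.
pose D n := (\bigcup_i F i) `\` \big[setU/set0]_(i < n) F i.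
have mS n : measurable (\big[setU/set0]_(i < n) F i) by apply: bigsetU_measurable => i _.
have mD n : measurable (D n) by exact: measurableD.
have DE n : defect (\bigcup_i F i) = defect (\big[setU/set0]_(i < n) F i) + defect (D n).
  rewrite -defectU//; last by rewrite setDIK.
  congr defect; rewrite setDUK// => x; rewrite -bigcup_mkord => -[i _ Fx].
  by exists i.
under eq_fun do rewrite sumE.
apply: cvg_EFin; first exact: nearW.
apply/cvgrPdist_le => e e0.
have b1 : 0 < 1 + `|b| by rewrite ltr_pwDl.
have Dx x : exists N, forall n, (N <= n)%N -> ~ D n x.
  have [[i _ Fix]|nF] := pselect ((\bigcup_i F i) x); last by exists 0%N => n _ [].
  by exists i.+1 => n ni [_]; apply; rewrite -bigcup_mkord; exists i.
have [N NP] := res_cvg0 v mD Dx (divr_gt0 e0 b1).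
exists N => // n Nn /=; rewrite (DE n) addrC addKr (le_trans (defect_le _))//.
by rewrite mulrC -ler_pdivlMr//; exact: NP.
Qed.

HB.instance Definition _ := isCharge.Build _ _ _ edefect
  edefect0 edefect_fin edefect_sigma_additive.

Lemma hahn_defect : exists2 P, measurable P &
  (forall E, measurable E -> E `<=` P -> 0 <= defect E) /\
  (forall E, measurable E -> E `<=` ~` P -> defect E <= 0).
Proof.
have [P [N [[mP Ppos] [mN Nneg] PN PN0]]] := Hahn_decomposition edefect.
exists P => //; split=> E mE EP; first by rewrite -lee_fin; exact: Ppos.
rewrite -lee_fin; apply: Nneg => // x /EP nPx.
by have : setT x by []; rewrite -PN => -[].
Qed.

End Hahn.

(** With [P] the Hahn set at level [1 - b], each unit of mass of [v] outside [P] costs [phi] at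
    least [b]. The total loss is at most [eta], so the mass outside is at most [eta / b]. Inside,
    the inequality holds at the restrictions of [v] and spreads by [pos_cone_dense]. *)
Lemma large_functional_on_cone d (T : measurableType d) (R : realType) (k : scalarKind)
    (mu : {measure set T -> \bar R}) (phi : {linear L1 k mu -> (scalarField R k)^o})
    (v : L1 k mu) (b eta : R) :
  (forall u, rn (phi u) <= rn u) -> pos v -> rn v <= 1 -> 0 < b -> b <= 1 ->
  1 - eta <= re_part (phi v) ->
  exists C, [/\ measurable C, C `<=` supp v, rn (res (~` C) v) <= eta / b &
    forall u, pos u -> res C u = u -> (1 - b) * rn u <= re_part (phi u)].
Proof.
move=> phi_le pv v1 b0 b1 phiv.
have [P mP [Pge Ple]] := hahn_defect v (1 - b) phi_le.
have mS := measurable_supp v.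
have mC : measurable (P `&` supp v) by exact: measurableI.
have mPc : measurable (~` P) by exact: measurableC.
have eC : res (P `&` supp v) v = res P v by rewrite -res_res// res_supp.
exists (P `&` supp v); split => //.
- have -> : res (~` (P `&` supp v)) v = res (~` P) v.
    have mCc : measurable (~` (P `&` supp v)) by exact: measurableC.
    have e E : measurable E -> res E v = res (E `&` supp v) v.
      by move=> mE; rewrite -res_res// res_supp.
    by rewrite e// [RHS]e// setCI setIUl setICl setU0.
  rewrite ler_pdivlMr//.
  have := Ple _ mPc (@subset_refl _ _); rewrite /defect => h1.
  have h2 := rn_split v mP.
  have h3 : re_part (phi (res P v)) <= rn (res P v).
    by apply: le_trans (phi_le _); apply: le_trans (re_part_le _); exact: ler_norm.
  have h4 : re_part (phi v) = re_part (phi (res P v)) + re_part (phi (res (~` P) v)).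
    by rewrite -re_partD -linearD/= res_split.
  nra.
- move=> u pu Cu.
  (* [pos] is carried along because the inequality is stable under sums only where the norm is
     additive. *)
  suff [] : pos u /\ (1 - b) * rn u <= re_part (phi u) by [].
  apply: (pos_cone_dense mC (W := fun w => pos w /\ (1 - b) * rn w <= re_part (phi w))
    (p := v) _ _ _ _ _ pv pu Cu) => //.
  + move=> w w' [pw hw] [pw' hw']; split; first exact: posD.
    by rewrite rn_posD// linearD/= re_partD mulrDr lerD.
  + move=> a w a0 [pw hw]; split; first exact: posZ.
    rewrite rnZ rnorm_of_real ger0_norm// linearZ/= [_ *: _](_ : _ = of_real k a * phi w)//.
    by rewrite re_partM re_part_of_real im_part_of_real mul0r subr0 mulrCA ler_wpM2l.
  + move=> w hw; split; first by apply: pos_closed => e /hw[w' []]; exists w'.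
    apply/ler_addgt0Pr => e e0; have e2 : 0 < e / 2 by rewrite divr_gt0.
    have [w' [pw' hw'] ww'] := hw _ e2.
    have h1 : re_part (phi w') - re_part (phi w) <= rn (w - w').
      rewrite -re_partB -linearB/= rn_distC (le_trans _ (phi_le _))//.
      by apply: le_trans (re_part_le _); exact: ler_norm.
    have h2 := rn_le_sub w w'; have := rn_ge0 (w - w'); have := rn_ge0 w; have := rn_ge0 w'.
    nra.
  + move=> E mE EC; split; first exact: pos_res.
    by rewrite -subr_ge0; apply: Pge => // x /EC[].
Qed.

Definition linear_pack (K : numFieldType) (V W : lmodType K) (f : V -> W)
  (lf : linear f) : {linear V -> W} := HB.pack f (GRing.isLinear.Build K V W *:%R f lf).

(** * Limits of sequences in the real-valued norm, and linear spans of positive functions *)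

Section Limits.
Context (R : realType) (k : scalarKind).
Notation K := (scalarField R k).

Definition rn_lim (V : normedModType K) (x : nat -> V) (l : V) :=
  forall e : R, 0 < e -> exists N, forall n, (N <= n)%N -> rn (l - x n) <= e.

Lemma rn_lim_unique (V : normedModType K) (x : nat -> V) l l' :
  rn_lim x l -> rn_lim x l' -> l = l'.
Proof.
move=> xl xl'; apply/eqP; rewrite -subr_eq0; apply/eqP/rn_small => e e0.
have e2 : 0 < e / 2 by rewrite divr_gt0.
have [N NP] := xl _ e2; have [N' NP'] := xl' _ e2.
have := NP _ (leq_maxl N N'); have := NP' _ (leq_maxr N N').
rewrite rn_distC; have := rn_triangle (x (maxn N N')) l l'; lra.
Qed.

Lemma rn_lim_linear (V : normedModType K) (a : K) (x y : nat -> V) l m :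
  rn_lim x l -> rn_lim y m -> rn_lim (fun n => a *: x n + y n) (a *: l + m).
Proof.
move=> xl ym e e0; have e2 : 0 < e / 2 by rewrite divr_gt0.
have a1 : 0 < rnorm a + 1 by rewrite ltr_wpDl// rnorm_ge0.
have [N NP] := xl _ (divr_gt0 e2 a1); have [N' NP'] := ym _ e2.
exists (maxn N N') => n; rewrite geq_max => /andP[/NP h /NP' h'].
rewrite opprD addrACA -scalerBr (le_trans (rnD _ _))// [leRHS]splitr lerD//.
rewrite rnZ (le_trans (ler_wpM2l (rnorm_ge0 _) h))//.
by rewrite mulrCA ler_piMr ?(ltW e2)// ler_pdivrMr// mul1r lerDl.
Qed.

Lemma rn_complete (V : completeNormedModType K) (x : nat -> V) :
  (forall e : R, 0 < e -> exists N, forall n m, (N <= n)%N -> (N <= m)%N ->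
    rn (x n - x m) <= e) ->
  exists l, rn_lim x l.
Proof.
move=> xC.
have cx : cvgn x.
  apply/cauchy_cvgP/cauchyP => e e0.
  have eE : of_real k (rnorm e) = e by rewrite of_real_rnorm gtr0_norm.
  have re0 : 0 < rnorm e by rewrite -(ltr_of_real k) eE of_real0.
  have [N NP] := xC _ (divr_gt0 re0 (ltr0Sn R 1)).
  exists (x N), N => // n /= Nn; rewrite -ball_normE /ball_/= -eE -of_real_rn ltr_of_real.
  by rewrite (le_lt_trans (NP _ _ (leqnn N) Nn))// ltr_pdivrMr// ltr_pMr// ltr1n.
exists (limn x) => e e0.
have e0' : 0 < of_real k e by rewrite -(of_real0 R k) ltr_of_real.
have /cvgrPdist_le /(_ _ e0')[N _ NP] := cx.
by exists N => n Nn; rewrite -(ler_of_real k) of_real_rn; exact: NP.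
Qed.

End Limits.

Lemma sum_prod (V : nmodType) (I J : finType) (F : I * J -> V) :
  \sum_x F x = \sum_i \sum_j F (i, j).
Proof. by rewrite pair_bigA; apply: eq_bigr => -[]. Qed.

(** The approximants of [u] are the sums of the functions [a_i 1_{E_i} |u|] given by
    [polar_cells]. *)
Lemma pos_spans d (T : measurableType d) (R : realType) (k : scalarKind)
    (mu : {measure set T -> \bar R}) (W : L1 k mu -> Prop) :
  (forall (a : scalarField R k) u v, W u -> W v -> W (a *: u + v)) ->
  (forall u, (forall e, 0 < e -> exists2 w, W w & rn (u - w) <= e) -> W u) ->
  (forall u, pos u -> W u) -> forall u, W u.
Proof.
move=> Wlin Wcl Wpos u; apply: Wcl => e e0.
have r1 : 0 < rn u + 1 by rewrite ltr_wpDl// rn_ge0.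
have [I [c [a [mc _ ca]]]] := polar_cells u (divr_gt0 e0 r1).
exists (\sum_i a i *: res (c @^-1` [set i]) (L1abs u)).
  elim/big_rec: _ => [|i w _ Ww]; first exact/Wpos/pos0.
  by apply: Wlin => //; apply: Wpos; apply: pos_res; [exact: mc|exact: pos_L1abs].
rewrite -{1}(colouring_sum u mc) -sumrB (le_trans (rn_sum _ _ _))//.
apply: (@le_trans _ _ (\sum_i e / (rn u + 1) * rn (res (c @^-1` [set i]) u))).
  by apply: ler_sum => i _; exact: ca.
rewrite -mulr_sumr colouring_rn// mulrAC -mulrA ler_piMr ?(ltW e0)//.
by rewrite ler_pdivrMr// mul1r lerDl.
Qed.

(** * Partition approximations to the modulus of an operator *)

Section Modulus.
Context d (T : measurableType d) d' (U : measurableType d') (R : realType) (k : scalarKind).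
Variables (mu : {measure set T -> \bar R}) (nu : {measure set U -> \bar R}).
Notation K := (scalarField R k).
Notation L1m := (L1 k mu).
Notation L1n := (L1 k nu).
Variables (A : {linear L1m -> L1n}) (p : L1m).
Hypothesis A_le : forall u, rn (A u) <= rn u.

Definition piece (I : finType) (c : T -> I) i : {linear L1m -> L1m} :=
  res (c @^-1` [set i]).

(** The phases are read off at [p] and not at [u], which keeps the map linear; disjointness of the
    cells keeps it a contraction. *)
Definition approx (I : finType) (c : T -> I) (u : L1m) : L1n :=
  \sum_i Mul (phase (repr (A (piece c i p)))) (A (piece c i u)).

Definition variation (I : finType) (c : T -> I) : R := \sum_i rn (A (piece c i p)).

Lemma approx_is_linear (I : finType) (c : T -> I) : linear (approx c).
Proof.
move=> a u v; rewrite /approx scaler_sumr -big_split/=; apply: eq_bigr => i _.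
by rewrite !linearP.
Qed.

HB.instance Definition _ (I : finType) (c : T -> I) :=
  GRing.isLinear.Build K L1m L1n *:%R (approx c) (approx_is_linear c).

Lemma rn_approx (I : finType) (c : T -> I) u : colouring c -> rn (approx c u) <= rn u.
Proof.
move=> mc; rewrite (le_trans (rn_sum _ _ _))// -[leRHS](colouring_rn _ mc).
apply: ler_sum => i _; rewrite rn_Mul ?A_le//; exact: unimodular_phase.
Qed.

Lemma variation_le (I : finType) (c : T -> I) : colouring c -> variation c <= rn p.
Proof.
by move=> mc; rewrite -(colouring_rn p mc); apply: ler_sum => i _; exact: A_le.
Qed.

Section Gap.
Variable s : R.
Hypothesis s_ub : forall (I : finType) (c : T -> I), colouring c -> variation c <= s.

(** The double sum is the variation of the common refinement of [c], [e] and the partition by [E].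
    The set [E] enters because convergence is wanted at every [1_E p], while the partitions are
    optimised at [p]. *)
Lemma variation_refine (I J : finType) (c : T -> I) (e : T -> J) E :
  colouring c -> colouring e -> measurable E ->
  \sum_i \sum_j (rn (A (piece c i (piece e j (res E p)))) +
                 rn (A (piece c i (piece e j (res (~` E) p))))) <= s.
Proof.
move=> mc me mE.
have mEc := colouring_set mE; have meE := colouring_pair me mEc.
apply: le_trans (s_ub (colouring_pair mc meE)).
rewrite le_eqVlt; apply/orP; left; apply/eqP.
rewrite /variation sum_prod; apply: eq_bigr => i _.
rewrite sum_prod; apply: eq_bigr => j _.
have q b v : res ((fun x => (c x, (e x, x \in E))) @^-1` [set (i, (j, b))]) v =
    res (c @^-1` [set i]) (res (e @^-1` [set j]) (res ((fun x => x \in E) @^-1` [set b]) v)).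
  by rewrite -(colouring_res_pair _ _ _ me mEc) -(colouring_res_pair _ _ _ mc meE).
rewrite big_bool /piece /= !q.
congr (rn (A (res _ (res _ (res _ p)))) + rn (A (res _ (res _ (res _ p))))).
- by apply/seteqP; split => x /=; [exact: mem_set|exact: set_mem].
- apply/seteqP; split => x /=; first by move=> h; rewrite memNset.
  by move=> h /mem_set; rewrite h.
Qed.

(* Near-maximality of [variation c] forces the phases to be nearly constant on every
   refinement of [c], so that [approx c] nearly agrees there with the modulus. *)
Lemma approx_gap (I J : finType) (c : T -> I) (e : T -> J) E (t : R) :
  0 < t -> colouring c -> colouring e -> measurable E ->
  rn (approx c (res E p) - \sum_i \sum_j L1abs (A (piece c i (piece e j (res E p)))))
    <= (s - variation c) / t + t * s.
Proof.
move=> t0 mc me mE.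
pose z i j F := A (piece c i (piece e j (res F p))).
pose ph i := phase (repr (A (piece c i p))).
have uph i : unimodular (ph i) by exact: unimodular_phase.
pose G i j F := (rn (z i j F) - re_part (L1int (Mul (ph i) (z i j F)))) / t + t * rn (z i j F).
have G_ge i j F : rn (Mul (ph i) (z i j F) - L1abs (z i j F)) <= G i j F.
  exact: rn_Mul_sub_L1abs.
have G0 i j F : 0 <= G i j F by apply: le_trans (G_ge i j F); exact: rn_ge0.
(* The nonnegative terms of the complement are added so that the total is governed by the variation
   of a refinement. *)
apply: (@le_trans _ _ (\sum_i \sum_j (G i j E + G i j (~` E)))).
  have -> : approx c (res E p) = \sum_i \sum_j Mul (ph i) (z i j E).
    apply: eq_bigr => i _; rewrite -{1}(colouring_sum (res E p) me).
    by rewrite !linear_sum.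
  rewrite -sumrB (le_trans (rn_sum _ _ _))//; apply: ler_sum => i _.
  rewrite -sumrB (le_trans (rn_sum _ _ _))//; apply: ler_sum => j _.
  by rewrite (le_trans (G_ge _ _ _))// lerDl.
(* [ph i] is the conjugate phase of the image of the whole cell, so the integrals over its
   refinement add up exactly to the norm of that image. *)
have HE i : \sum_j (re_part (L1int (Mul (ph i) (z i j E))) +
    re_part (L1int (Mul (ph i) (z i j (~` E))))) = rn (A (piece c i p)).
  transitivity (re_part (L1int (Mul (ph i) (A (piece c i (\sum_j piece e j p)))))).
    rewrite !linear_sum/=.
    rewrite (big_morph _ (@re_partD R k) (re_part0 R k)); apply: eq_bigr => j _.
    by rewrite -re_partD -!linearD/= res_split.
  rewrite colouring_sum// -[Mul _ _]/(L1abs (A (piece c i p))).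
  by rewrite pos_re ?rn_L1abs//; exact: pos_L1abs.
have vr := variation_refine mc me mE.
apply: (@le_trans _ _ ((\sum_i \sum_j (rn (z i j E) + rn (z i j (~` E))) - variation c) / t
   + t * \sum_i \sum_j (rn (z i j E) + rn (z i j (~` E))))).
  rewrite /variation -sumrB mulr_suml mulr_sumr -big_split/=; apply: ler_sum => i _.
  rewrite -HE -sumrB mulr_suml mulr_sumr -big_split/=; apply: ler_sum => j _.
  rewrite /G le_eqVlt; apply/orP; left; apply/eqP; field; exact: lt0r_neq0.
rewrite lerD ?ler_pM2l ?ler_pM2r ?invr_gt0//.
by rewrite lerD2r.
Qed.

(** Both approximations are compared with the sum of moduli over the common refinement, which is
    symmetric in [c] and [e] as restrictions commute. A defect [t^2] divided by [t] matches the
    other error [t * s] in order. *)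
Lemma approx_cauchy (I J : finType) (c : T -> I) (e : T -> J) E (t : R) :
  0 < t -> colouring c -> colouring e -> measurable E ->
  s - variation c <= t ^+ 2 -> s - variation e <= t ^+ 2 ->
  rn (approx c (res E p) - approx e (res E p)) <= 2 * ((1 + s) * t).
Proof.
move=> t0 mc me mE hc he.
have h1 := approx_gap t0 mc me mE; have h2 := approx_gap t0 me mc mE.
have b x : x <= t ^+ 2 -> x / t + t * s <= (1 + s) * t.
  move=> xt; rewrite mulrDl mul1r [s * t]mulrC lerD2r ler_pdivrMr//.
have := b _ hc; have := b _ he.
move: h1 h2; rewrite exchange_big/=.
set M := (X in rn (_ - X)); set M' := (X in _ -> rn (_ - X) <= _ -> _).
have -> : M' = M.
  apply: eq_bigr => i _; apply: eq_bigr => j _.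
  by rewrite /piece /= (res_comm _ (me i) (mc j)).
rewrite [rn (approx e _ - _)]rn_distC.
have := rn_triangle M (approx c (res E p)) (approx e (res E p)); lra.
Qed.

End Gap.

End Modulus.

(** * Convergence of the approximations and the resulting positive operator *)

Section ModulusLimit.
Context d (T : measurableType d) d' (U : measurableType d') (R : realType) (k : scalarKind).
Variables (mu : {measure set T -> \bar R}) (nu : {measure set U -> \bar R}).
Notation K := (scalarField R k).
Notation L1m := (L1 k mu).
Notation L1n := (L1 k nu).
Variables (A : {linear L1m -> L1n}) (p : L1m).
Hypothesis A_le : forall u, rn (A u) <= rn u.

Lemma variation_sup : exists s : R, [/\ 0 <= s,
  forall (I : finType) (c : T -> I), colouring c -> variation A p c <= s &
  forall e, 0 < e -> exists (I : finType) (c : T -> I),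
    colouring c /\ s - variation A p c <= e].
Proof.
pose S := [set x | exists (I : finType) (c : T -> I), colouring c /\ x = variation A p c].
have mtt : colouring (fun _ : T => tt).
  by move=> []; rewrite (_ : _ @^-1` _ = setT)//; apply/seteqP; split.
have Stt : S (variation A p (fun _ : T => tt)) by exists unit, (fun=> tt).
have hS : has_sup S.
  split; first by exists (variation A p (fun _ : T => tt)).
  by exists (rn p) => _ [I [c [mc ->]]]; exact: variation_le.
have ubS (I : finType) (c : T -> I) : colouring c -> variation A p c <= sup S.
  by move=> mc; apply: sup_upper_bound => //; exists I, c.
exists (sup S); split => //.
  by apply: le_trans (ubS _ _ mtt); apply: sumr_ge0 => i _; exact: rn_ge0.
move=> e e0; have [_ [I [c [mc ->]]] h] := sup_adherent e0 hS.
by exists I, c; split => //; lra.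
Qed.

(** The defects are squares because [approx_cauchy] turns a defect [t^2] into a distance of order
    [t]. *)
Lemma maximizing_colourings : exists (s : R) (I : nat -> finType) (c : forall n, T -> I n),
  [/\ 0 <= s, forall n, colouring (c n),
   forall (J : finType) (e : T -> J), colouring e -> variation A p e <= s &
   forall n, s - variation A p (c n) <= (2 ^- n) ^+ 2].
Proof.
have [s [s0 sub sapp]] := variation_sup.
have /choice[x xP] : forall n, exists x : {I : finType & T -> I},
    colouring (projT2 x) /\ s - variation A p (projT2 x) <= (2 ^- n) ^+ 2.
  move=> n; have [I [c cP]] : exists (I : finType) (c : T -> I),
      colouring c /\ s - variation A p c <= (2 ^- n) ^+ 2.
    by apply: sapp; rewrite !exprn_gt0// invr_gt0 exprn_gt0.
  by exists (existT _ I c).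
by exists s, (fun n => projT1 (x n)), (fun n => projT2 (x n)); split => // n;
  case: (xP n).
Qed.

Lemma exprV2_lt (e M : R) : 0 < e -> 0 <= M ->
  exists N, forall n, (N <= n)%N -> M * 2 ^- n <= e.
Proof.
move=> e0 M0; have M1 : 0 < M + 1 by rewrite ltr_wpDl.
have [N _ NP] := near_infty_natSinv_expn_lt (PosNum (divr_gt0 e0 M1)).
exists N => n /NP /=; rewrite div1r ltr_pdivlMr// mulrDr mulr1 mulrC => h.
have : 0 <= (2 ^- n : R) by rewrite invr_ge0 exprn_ge0.
move: h; set y := 2 ^- n; rewrite -/y; lra.
Qed.

(** Near-maximality gives convergence only at restrictions of [p]. [pos_cone_dense] extends it to
    positive functions on [C] and [pos_spans] to all functions on [C]; uniform contractivity of the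
    approximations gives closure under limits. *)
Lemma modulus_operator (C : set T) (b t : R) :
  pos p -> measurable C -> C `<=` supp p -> 0 < t -> 0 <= b ->
  (forall u, pos u -> res C u = u -> (1 - b) * rn u <= re_part (L1int (A u))) ->
  exists M : {linear L1m -> L1n}, (forall u, rn (M u) <= rn u) /\
    forall u, pos u -> res C u = u ->
      pos (M u) /\ rn (M u - A u) <= (b / t + t) * rn u.
Proof.
move=> pp mC Cp t0 b0 hA.
have [s [I [c [s0 mc s_ub c_max]]]] := maximizing_colourings.
have [Q QE] : exists Q : nat -> {linear L1m -> L1n}, forall n u, Q n u = approx A p (c n) u.
  by exists (fun n => approx A p (c n)).
have Q_le n u : rn (Q n u) <= rn u by rewrite QE; apply: rn_approx.
have B0 : 0 <= b / t + t by have t0' := ltW t0; rewrite addr_ge0 ?divr_ge0.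
pose cau u := forall e : R, 0 < e -> exists N, forall n m, (N <= n)%N -> (N <= m)%N ->
  rn (Q n u - Q m u) <= e.
pose near_pos u := forall e : R, 0 < e -> exists N, forall n, (N <= n)%N ->
  exists2 w, pos w & rn (Q n u - w) <= e.
pose near_A u := forall e : R, 0 < e -> exists N, forall n, (N <= n)%N ->
  rn (Q n u - A u) <= (b / t + t) * rn u + e.
have cau_lin (a : K) u v : cau u -> cau v -> cau (a *: u + v).
  move=> hu hv e e0; have e2 : 0 < e / 2 by rewrite divr_gt0.
  have a1 : 0 < rnorm a + 1 by rewrite ltr_wpDl// rnorm_ge0.
  have [N NP] := hu _ (divr_gt0 e2 a1); have [N' NP'] := hv _ e2.
  exists (maxn N N') => n m; rewrite !geq_max => /andP[n1 n2] /andP[m1 m2].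
  rewrite !(linearP (Q _)) /= opprD addrACA -scalerBr (le_trans (rnD _ _))// [leRHS]splitr lerD//.
    rewrite rnZ (le_trans (ler_wpM2l (rnorm_ge0 _) (NP _ _ n1 m1)))//.
    by rewrite mulrCA ler_piMr ?(ltW e2)// ler_pdivrMr// mul1r lerDl.
  exact: NP'.
have cau_cl u : (forall e, 0 < e -> exists2 w, cau w & rn (u - w) <= e) -> cau u.
  move=> h e e0; have e3 : 0 < e / 3 by rewrite divr_gt0.
  have [w hw uw] := h _ e3; have [N NP] := hw _ e3; exists N => n m n1 m1.
  have Quw j : rn (Q j u - Q j w) <= e / 3 by rewrite -(linearB (Q j)) (le_trans (Q_le _ _)).
  have Qwu j : rn (Q j w - Q j u) <= e / 3 by rewrite rn_distC; exact: Quw.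
  apply: le_trans (rn_triangle_le (Quw n) (rn_triangle_le (NP _ _ n1 m1) (Qwu m))) _.
  by rewrite le_eqVlt; apply/orP; left; apply/eqP; field.
(* The one-cell partition: the gap estimate is used here without further refinement. *)
pose m0 (x : T) := tt.
have mm0 : colouring m0.
  by move=> []; rewrite (_ : _ @^-1` _ = setT)//; apply/seteqP; split.
pose w n E i j := piece k mu (c n) i (piece k mu m0 j (res E p)).
pose M n E := \sum_i \sum_j L1abs (A (w n E i j)).
have QM n E : measurable E -> rn (Q n (res E p) - M n E) <= (1 + s) * 2 ^- n.
  move=> mE; have tn : 0 < (2 ^- n : R) by rewrite invr_gt0 exprn_gt0.
  rewrite QE (le_trans (approx_gap s_ub tn (mc n) mm0 mE))//.
  by rewrite [leRHS]mulrDl mul1r [s * _]mulrC lerD2r ler_pdivrMr.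
have MA n E : measurable E -> E `<=` C ->
    rn (M n E - A (res E p)) <= (b / t + t) * rn (res E p).
  move=> mE EC.
  have sumw : \sum_i \sum_j rn (w n E i j) = rn (res E p).
    rewrite -(colouring_rn (res E p) (mc n)); apply: eq_bigr => i _.
    rewrite -(colouring_rn (res _ (res E p)) mm0); apply: eq_bigr => j _.
    by rewrite /w /piece /= (res_comm _ (mc n i) (mm0 j)).
  have -> : A (res E p) = \sum_i \sum_j A (w n E i j).
    rewrite -[in LHS](colouring_sum (res E p) (mc n)) linear_sum; apply: eq_bigr => i _.
    rewrite -[X in res _ X](colouring_sum (res E p) mm0).
    by rewrite (linear_sum (res _)) (linear_sum A).
  rewrite -sumrB (le_trans (rn_sum _ _ _))// -sumw mulr_sumr; apply: ler_sum => i _.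
  rewrite -sumrB (le_trans (rn_sum _ _ _))// mulr_sumr; apply: ler_sum => j _.
  have pw : pos (w n E i j).
    by rewrite /w /piece /=; apply: pos_res; [exact: mc|apply: pos_res; [exact: mm0|exact: pos_res]].
  have Cw : res C (w n E i j) = w n E i j.
    rewrite /w /piece /= (res_comm _ mC (mc n i)) (res_comm _ mC (mm0 j)).
    by rewrite (res_res _ mC mE) setIidr.
  (* The integral of [A w] has real part at least [(1 - b) * rn w] and the norm of [A w] is at most
     [rn w], so the defect is at most [b * rn w]. *)
  have := rn_Mul_sub_L1abs (A (w n E i j)) t0 (@unimodular1 _ _ R k).
  rewrite Mul1 rn_distC => /le_trans; apply.
  rewrite [leRHS]mulrDl lerD ?ler_pM2l// mulrAC ler_pM2r ?invr_gt0//.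
  rewrite lerBlDr -lerBlDl (le_trans _ (hA _ pw Cw))// mulrBl mul1r lerD2r; exact: A_le.
have basic E : measurable E -> E `<=` C -> [/\ cau (res E p), near_pos (res E p) & near_A (res E p)].
  move=> mE EC; split=> e e0.
  - have [N NP] := exprV2_lt e0 (mulr_ge0 (ler0n R 2) (addr_ge0 ler01 s0)).
    exists N => n m n1 m1.
    (* The smaller index has the larger tolerance [2^-n], which then serves for both partitions. *)
    wlog nm : n m n1 m1 / (n <= m)%N.
      move=> H; have [nm|/ltnW nm] := leqP n m; first exact: H.
      by rewrite rn_distC; exact: H.
    have tn : 0 < (2 ^- n : R) by rewrite invr_gt0 exprn_gt0.
    apply: le_trans (NP _ n1); rewrite -mulrA !QE.
    apply: (approx_cauchy s_ub) => //; apply: (le_trans (c_max _)) => //.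
    rewrite ler_pXn2r ?nnegrE ?invr_ge0 ?exprn_ge0// lef_pV2 ?posrE ?exprn_gt0//.
    by rewrite ler_weXn2l// ler1n.
  - have [N NP] := exprV2_lt e0 (addr_ge0 ler01 s0).
    exists N => n n1; exists (M n E).
      by apply: pos_sum => i _; apply: pos_sum => j _; exact: pos_L1abs.
    exact: le_trans (QM n E mE) (NP n n1).
  - have [N NP] := exprV2_lt e0 (addr_ge0 ler01 s0).
    exists N => n n1; rewrite [leRHS]addrC.
    exact: (rn_triangle_le (le_trans (QM n E mE) (NP n n1)) (MA n E mE EC)).
have good u : pos u -> res C u = u -> [/\ pos u, cau u, near_pos u & near_A u].
  move=> pu Cu.
  apply: (pos_cone_dense mC Cp (W := fun u => [/\ pos u, cau u, near_pos u & near_A u])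
    _ _ _ _ pp pu Cu).
  - move=> v v' [pv cv nv av] [pv' cv' nv' av']; split; first exact: posD.
    + by rewrite -[v]scale1r; exact: cau_lin.
    + move=> e e0; have e2 : 0 < e / 2 by rewrite divr_gt0.
      have [N NP] := nv _ e2; have [N' NP'] := nv' _ e2.
      exists (maxn N N') => n; rewrite geq_max => /andP[/NP[x px hx] /NP'[x' px' hx']].
      exists (x + x'); first exact: posD.
      by rewrite (linearD (Q n)) opprD addrACA (le_trans (rnD _ _))// [leRHS]splitr lerD.
    + move=> e e0; have e2 : 0 < e / 2 by rewrite divr_gt0.
      have [N NP] := av _ e2; have [N' NP'] := av' _ e2.
      exists (maxn N N') => n; rewrite geq_max => /andP[/NP h /NP' h'].
      rewrite (linearD (Q n)) (linearD A) opprD addrACA (le_trans (rnD _ _))// rn_posD// mulrDr.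
      by rewrite [in leRHS](splitr e) addrACA lerD.
  - move=> a v a0 [pv cv nv av]; split; first exact: posZ.
    + rewrite -[_ *: v]addr0; apply: cau_lin => // e e0.
      by exists 0%N => n m _ _; rewrite (linear0 (Q n)) (linear0 (Q m)) subrr rn0 ltW.
    + move=> e e0; have a1 : 0 < a + 1 by rewrite ltr_wpDl.
      have [N NP] := nv _ (divr_gt0 e0 a1); exists N => n /NP[x px hx].
      exists (of_real k a *: x); first exact: posZ.
      rewrite (linearZZ (Q n)) -scalerBr rnZ rnorm_of_real ger0_norm// (le_trans (ler_wpM2l a0 hx))//.
      by rewrite mulrCA ler_piMr ?(ltW e0)// ler_pdivrMr// mul1r lerDl.
    + move=> e e0; have a1 : 0 < a + 1 by rewrite ltr_wpDl.
      have [N NP] := av _ (divr_gt0 e0 a1); exists N => n /NP hx.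
      rewrite (linearZZ (Q n)) (linearZZ A) -scalerBr !rnZ rnorm_of_real ger0_norm// (le_trans (ler_wpM2l a0 hx))//.
      rewrite mulrDr mulrCA lerD2l.
      by rewrite mulrCA ler_piMr ?(ltW e0)// ler_pdivrMr// mul1r lerDl.
  - move=> v hv; split.
    + by apply: pos_closed => e /hv[x [px _ _ _] ?]; exists x.
    + by apply: cau_cl => e /hv[x [_ cx _ _] ?]; exists x.
    + move=> e e0; have e2 : 0 < e / 2 by rewrite divr_gt0.
      have [x [_ _ nx _] vx] := hv _ e2; have [N NP] := nx _ e2.
      exists N => n /NP[y py hy]; exists y => //.
      have Qvx : rn (Q n v - Q n x) <= e / 2 by rewrite -(linearB (Q n)) (le_trans (Q_le _ _)).
      by rewrite (splitr e); exact: (rn_triangle_le Qvx hy).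
    (* With [B = b / t + t] and [y] the chosen precision, three errors [y] and the change of
       [B * rn x] by at most [B * y] add up to [(B + 3) * y = e]. *)
    + move=> e e0; have B1 : 0 < b / t + t + 3 by rewrite ltr_wpDl.
      have e3 : 0 < e / (b / t + t + 3) by rewrite divr_gt0.
      have [x [_ _ _ ax] vx] := hv _ e3; have [N NP] := ax _ e3.
      exists N => n /NP h.
      have Qvx : rn (Q n v - Q n x) <= e / (b / t + t + 3).
        by rewrite -(linearB (Q n)) (le_trans (Q_le _ _)).
      have Axv : rn (A x - A v) <= e / (b / t + t + 3).
        by rewrite -(linearB A) (le_trans (A_le _))// rn_distC.
      apply: le_trans (rn_triangle_le Qvx (rn_triangle_le h Axv)) _.
      have xv : rn (x - v) <= e / (b / t + t + 3) by rewrite rn_distC.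
      have := ler_wpM2l B0 (rn_le_subr (lexx (rn v)) xv).
      have : e / (b / t + t + 3) * (b / t + t + 3) = e by rewrite divfK// gt_eqF.
      move: (rn x) (rn v) e3; set B := b / t + t; set y := e / _ => r r' y0 yB hr.
      by move: hr yB; rewrite (mulrDr B) (mulrDr y B 3) (mulrC y B); lra.
  - move=> E mE EC; have [c1 c2 c3] := basic E mE EC.
    by split => //; exact: pos_res.
have all_cau u : cau (res C u).
  apply: (pos_spans (W := fun u => cau (res C u))) => [a v v'|v hv|v pv].
  - by rewrite (linearP (res C)); exact: cau_lin.
  - apply: cau_cl => e e0; have [x cx vx] := hv _ e0; exists (res C x) => //.
    by rewrite -(linearB (res C)) (le_trans (rn_Mul_le _ _)).
  - by case: (good (res C v)) => //; [exact: pos_res|exact: res_idem].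
(* Restricting to [C] before taking the limit defines the operator on all of [L_1]. *)
have /choice[L LP] : forall u, exists l, rn_lim (fun n => Q n (res C u)) l.
  by move=> u; apply: rn_complete; exact: all_cau.
have Llin : linear L.
  move=> a u v; have := rn_lim_linear a (LP u) (LP v).
  rewrite (_ : (fun n => _) = (fun n => Q n (res C (a *: u + v)))).
    by move=> h; exact: rn_lim_unique (LP _) h.
  by apply/funext => n; rewrite (linearP (res C)) (linearP (Q n)).
exists (linear_pack Llin); split=> [u|u pu Cu] /=.
  apply/ler_addgt0Pr => e e0; have [N /(_ N (leqnn N)) NP] := LP u e e0.
  exact: rn_le_subr (le_trans (Q_le _ _) (rn_Mul_le _ u)) NP.
have [_ _ nu_ au] := good u pu Cu; split.
  apply: pos_closed => e e0; have e2 : 0 < e / 2 by rewrite divr_gt0.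
  have [N NP] := LP u _ e2; have [N' NP'] := nu_ _ e2.
  have [x px hx] := NP' _ (leq_maxr N N'); exists x => //.
  have := NP _ (leq_maxl N N'); rewrite Cu => h.
  by rewrite (splitr e); exact: rn_triangle_le h hx.
apply/ler_addgt0Pr => e e0; have e2 : 0 < e / 2 by rewrite divr_gt0.
have [N NP] := LP u _ e2; have [N' NP'] := au _ e2.
have := NP' _ (leq_maxr N N'); have := NP _ (leq_maxl N N'); rewrite Cu => h h'.
rewrite [in leRHS](splitr e) addrCA; exact: rn_triangle_le h h'.
Qed.

End ModulusLimit.

(** * Between the operator norm and real-valued bounds *)

Section OperatorNorm.
Context (R : realType) (k : scalarKind).
Notation K := (scalarField R k).
Variables X Y : normedModType K.

Lemma bounded_operatorP (F : {linear X -> Y}) (M : R) :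
  (forall x, rn (F x) <= M * rn x) -> bounded_operator F.
Proof.
move=> FM; apply/linear_boundedP.
exists (of_real k `|M|); split; first by rewrite realE -(of_real0 R k) !ler_of_real normr_ge0.
move=> c Mc x; apply: (@le_trans _ _ (of_real k `|M| * `|x|)); last first.
  by rewrite ler_wpM2r// ltW.
rewrite -!of_real_rn -of_realM ler_of_real (le_trans (FM x))//.
by rewrite ler_wpM2r ?rn_ge0// ler_norm.
Qed.

(** Linearity is a hypothesis on a plain function so that the bound applies directly to differences
    such as [S \- T]. *)
Lemma opnorm_le (f : X -> Y) (M : R) : linear f -> 0 <= M ->
  (forall x, rn (f x) <= M * rn x) -> opnorm f <= of_real k M.
Proof.
move=> lf M0 fM; pose F := linear_pack lf.
have [_ lub] := opnorm_supremums (@bounded_operatorP F M fM).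
apply: lub => _ [x /= x1 <-]; rewrite -of_real_rn ler_of_real (le_trans (fM x))//.
by rewrite ler_piMr// -(ler_of_real k) of_real_rn of_real1.
Qed.

Lemma opnorm_ge (F : {linear X -> Y}) x : bounded_operator F -> rn x <= 1 ->
  of_real k (rn (F x)) <= opnorm F.
Proof.
move=> bF x1; have [ub _] := opnorm_supremums bF.
by apply: ub; exists x; rewrite ?of_real_rn//= -of_real_rn -(of_real1 R k) ler_of_real.
Qed.

Lemma contraction_of_opnorm1 (F : {linear X -> Y}) : bounded_operator F ->
  opnorm F = 1 -> forall x, rn (F x) <= rn x.
Proof.
move=> bF F1 x; have [x0|x0] := eqVneq (rn x) 0.
  by rewrite (_ : x = 0) ?linear0 ?rn0//; apply: rn_eq0; rewrite x0.
have xp : 0 < rn x by rewrite lt_neqAle eq_sym x0 rn_ge0.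
have := @opnorm_ge F (of_real k (rn x)^-1 *: x) bF.
rewrite linearZ/= !rnZ rnorm_of_real ger0_norm ?invr_ge0 ?rn_ge0// mulVf// => /(_ (lexx _)).
by rewrite F1 -(of_real1 R k) ler_of_real mulrC ler_pdivrMr// mul1r.
Qed.

Lemma opnorm1 (F : {linear X -> Y}) x : (forall x, rn (F x) <= rn x) ->
  rn x <= 1 -> 1 <= rn (F x) -> bounded_operator F /\ opnorm F = 1.
Proof.
move=> F1 x1 Fx; have F1' z : rn (F z) <= 1 * rn z by rewrite mul1r.
have bF : bounded_operator F by exact: bounded_operatorP F1'.
split=> //; apply/eqP; rewrite eq_le -(of_real1 R k) opnorm_le//=; last exact: linearP.
by apply: le_trans (opnorm_ge bF x1); rewrite ler_of_real.
Qed.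

End OperatorNorm.

(** * The perturbation when [x0] and its image are positive *)

Section PositiveCase.
Context d (T : measurableType d) d' (U : measurableType d') (R : realType) (k : scalarKind).
Variables (mu : {measure set T -> \bar R}) (nu : {measure set U -> \bar R}).
Notation K := (scalarField R k).
Notation L1m := (L1 k mu).
Notation L1n := (L1 k nu).

(** Off [C], [S] is [A]; on [C] it is an operator [P], positive there, plus a multiple of a positive
    unit vector [e] carried by [G] that restores the integral lost by [P]. For positive [u] on [C]
    the norms add up to [rn (P u) + (rn u - rn (P u)) = rn u]. The functional [y1] integrates over
    [G] and is [y0] elsewhere. *)
Lemma positive_case (A : {linear L1m -> L1n}) (y0 : {linear L1n -> K^o}) (x0 : L1m) (a : R) :
  (forall u, rn (A u) <= rn u) -> (forall v, rn (y0 v) <= rn v) ->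
  pos x0 -> rn x0 = 1 -> pos (A x0) -> 0 < a -> a <= 1 / 2 ->
  1 - a * (a ^+ 2 / 2) ^+ 2 / 2 <= re_part (y0 (A x0)) ->
  exists (S : {linear L1m -> L1n}) (y1 : {linear L1n -> K^o}) (x1 : L1m),
    [/\ forall u, rn (S u) <= rn u, forall v, rn (y1 v) <= rn v, rn x1 = 1 & y1 (S x1) = 1] /\
    [/\ rn (x1 - x0) <= 4 * a, forall v, rn (y1 v - y0 v) <= 4 * a * rn v &
        forall u, rn (S u - A u) <= 4 * a * rn u].
Proof.
(* The first Hahn step loses mass [eta / b = a b / 2], the second at most
   [(eta + eta / b) / b = (a b + a) / 2 <= a]. *)
move=> A_le y0_le px0 x01 pq a0 a1; set b := a ^+ 2 / 2; set eta := a * b ^+ 2 / 2 => y0q.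
have b0 : 0 < b by rewrite divr_gt0// exprn_gt0.
have ba : b <= a / 4 by rewrite /b; nra.
have eta0 : 0 < eta by rewrite divr_gt0// mulr_gt0// exprn_gt0.
have eb : eta / b = a * b / 2 by rewrite /eta; field; rewrite gt_eqF.
have b1 : b <= 1 by lra.
have x0le : rn x0 <= 1 by rewrite x01.
have q1 : rn (A x0) <= 1 by rewrite -x01; exact: A_le.
have [G [mG Gq hG coneG]] := large_functional_on_cone y0_le pq q1 b0 b1 y0q.
have mGc : measurable (~` G) by exact: measurableC.
have rnq : 1 - eta <= rn (A x0).
  apply: (le_trans y0q); apply: le_trans (y0_le _).
  by apply: le_trans (re_part_le _); exact: ler_norm.
have GA_lin : linear (fun u => res G (A u)).
  by move=> c u v; rewrite (linearP A) (linearP (res G)).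
have [GA GAE] : exists F : {linear L1m -> L1n}, forall u, F u = res G (A u).
  by exists (linear_pack GA_lin).
have GA_le u : rn (GA u) <= rn u by rewrite GAE (le_trans (rn_Mul_le _ _)).
have GGA u : res G (GA u) = GA u by rewrite GAE res_idem.
pose g := rn (GA x0).
have g_ge : 1 - eta - eta / b <= g.
  by rewrite lerBlDr (le_trans rnq)// /g GAE -(rn_split (A x0) mG) lerD2l.
have pGq : pos (GA x0) by rewrite GAE; exact: pos_res.
have phi_lin : linear (fun u => L1int (GA u)).
  by move=> c u v; rewrite (linearP GA) (linearP (@L1int _ _ R k nu)).
have [phi phiE] : exists F : {linear L1m -> K^o}, forall u, F u = L1int (GA u).
  by exists (linear_pack phi_lin).
have phi_le u : rn (phi u) <= rn u.
  by rewrite phiE; apply: le_trans (GA_le u); exact: rn_L1int_le.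
have phix0 : 1 - (eta + eta / b) <= re_part (phi x0).
  by rewrite phiE pGq re_part_of_real opprD addrA.
have [C [mC Cx hC coneC]] := large_functional_on_cone phi_le px0 x0le b0 b1 phix0.
have coneC' u : pos u -> res C u = u -> (1 - b) * rn u <= re_part (L1int (GA u)).
  by rewrite -phiE; exact: coneC.
have mCc : measurable (~` C) by exact: measurableC.
have [M [M_le Mcone]] := modulus_operator GA_le px0 mC Cx a0 (ltW b0) coneC'.
have bta : b / a + a = 3 / 2 * a by rewrite /b; field; rewrite gt_eqF.
rewrite bta in Mcone.
have h_small : (eta + eta / b) / b <= a.
  rewrite mulrDl eb (_ : a * b / 2 / b = a / 2); last by field; rewrite gt_eqF.
  by nra.
have g0 : 0 < g by apply: lt_le_trans g_ge; rewrite eb /eta; nra.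
pose e : L1n := of_real k g^-1 *: GA x0.
have gV0 : 0 <= g^-1 by rewrite invr_ge0 ltW.
have pe : pos e by exact: posZ.
have e1 : rn e = 1 by rewrite rnZ rnorm_of_real ger0_norm// -/g mulVf// gt_eqF.
have Ge : res G e = e by rewrite (linearZZ (res G)) /= GGA.
(* Cutting by [G] places the range where [y1] is the integral; it cannot increase the distance to
   [GA], whose range is already there. *)
have P_lin : linear (fun u => res G (M u)).
  by move=> c u v; rewrite (linearP M) (linearP (res G)).
have [P PE] : exists F : {linear L1m -> L1n}, forall u, F u = res G (M u).
  by exists (linear_pack P_lin).
have P_le u : rn (P u) <= rn u by rewrite PE (le_trans (rn_Mul_le _ _)).
(* The integral lost by [P]; on positive functions carried by [C] it is the loss of norm, hence
   nonnegative. *)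
pose coef u : K^o := L1int u - L1int (P u).
pose S0 u : L1n := A (res (~` C) u) + (P (res C u) + coef (res C u) *: e).
have coef_lin : linear coef.
  move=> c u v; rewrite /coef (linearP P) !(linearP (@L1int _ _ R k _)).
  by rewrite opprD addrACA -scalerBr.
have S0_lin : linear S0.
  move=> c u v; rewrite /S0 (linearP (res (~` C))) (linearP A) (linearP (res C)) (linearP P) coef_lin.
  have sA (z : K^o) : (c *: z) *: e = c *: (z *: e) by exact: (esym (scalerA c z e)).
  by rewrite scalerDl sA !scalerDr [X in _ + X = _]addrACA [LHS]addrACA.
have [S SE] : exists F : {linear L1m -> L1n}, forall u, F u = S0 u.
  by exists (linear_pack S0_lin).
have y1_lin : linear (fun v => L1int (res G v) + y0 (res (~` G) v) : K^o).
  move=> c u v; rewrite (linearP (res G)) (linearP (res (~` G))).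
  by rewrite (linearP (@L1int _ _ R k _)) (linearP y0) scalerDr addrACA.
have [y1 y1E] : exists F : {linear L1n -> K^o},
    forall v, F v = L1int (res G v) + y0 (res (~` G) v).
  by exists (linear_pack y1_lin).
pose h := rn (res C x0).
have hE : h + rn (res (~` C) x0) = 1 by rewrite rn_split.
have h_ge : 1 - a <= h.
  by rewrite -hE lerBlDr lerD2l (le_trans hC).
have h0 : 0 < h by apply: lt_le_trans h_ge; lra.
pose x1 := of_real k h^-1 *: res C x0.
have hV0 : 0 <= h^-1 by rewrite invr_ge0 ltW.
have px1 : pos x1 by apply: posZ => //; exact: pos_res.
have x11 : rn x1 = 1 by rewrite rnZ rnorm_of_real ger0_norm// -/h mulVf// gt_eqF.
have Cx1 : res C x1 = x1 by rewrite (linearZZ (res C)) /= res_idem.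
have coef_pos u : pos u -> res C u = u -> coef u = of_real k (rn u - rn (P u)).
  move=> pu Cu; have [pM _] := Mcone u pu Cu.
  have pP : pos (P u) by rewrite PE; exact: pos_res.
  by rewrite /coef [L1int u]pu [L1int (P u)]pP of_realB.
have PGA u : pos u -> res C u = u -> rn (P u - GA u) <= 3 / 2 * a * rn u.
  move=> pu Cu; have [_] := Mcone u pu Cu; apply: le_trans.
  by rewrite PE -[X in rn (_ - X) <= _]GGA -(linearB (res G)); exact: rn_Mul_le.
have GAlow u : pos u -> res C u = u -> (1 - b) * rn u <= rn (GA u).
  move=> pu Cu; rewrite (le_trans (coneC' u pu Cu))//; exact: re_L1int_le.
(* [A u] has norm at most [rn u] and its part on [G] already has [(1 - b) * rn u], so at most
   [b * rn u] is left outside. *)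
have GAA u : pos u -> res C u = u -> rn (GA u - A u) <= b * rn u.
  move=> pu Cu; rewrite rn_distC GAE -{1}(res_split (A u) mG) [res G _ + _]addrC addrK.
  rewrite -(lerD2l (rn (res G (A u)))) rn_split// -GAE (le_trans (A_le u))//.
  by rewrite -lerBlDr -{1}[rn u]mul1r -mulrBl; exact: GAlow.
have Plow u : pos u -> res C u = u -> rn u - rn (P u) <= (b + 3 / 2 * a) * rn u.
  move=> pu Cu; have := GAlow u pu Cu; have := rn_le_subr (lexx (rn (P u))) (_ : rn (GA u - P u) <= _).
  move=> /(_ (3 / 2 * a * rn u)); rewrite rn_distC => /(_ (PGA u pu Cu)).
  by move: (rn u) (rn (P u)) (rn (GA u)); clear => *; lra.
have Sx1 : S x1 = P x1 + coef x1 *: e.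
  by rewrite SE /S0 Cx1 -{1}Cx1 resC_res// (linear0 A) add0r.
have y1Sx1 : y1 (S x1) = 1.
  have GS : res G (S x1) = S x1.
    by rewrite Sx1 (linearD (res G)) (linearZZ (res G)) /= Ge PE res_idem.
  rewrite y1E -{2}GS resC_res// (linear0 y0) addr0 GS Sx1.
  rewrite (linearD (@L1int _ _ R k _)) (linearZZ (@L1int _ _ R k _)) /= [L1int e]pe e1.
  rewrite of_real1 [_ *: 1](_ : _ = coef x1); last exact: mulr1.
  by rewrite /coef addrC subrK [L1int x1]px1 x11 of_real1.
have rn_coef u : rnorm (coef u) <= 2 * rn u.
  rewrite -rnK (le_trans (rnB _ _))// mulrDl mul1r lerD ?rn_L1int_le//.
  by apply: le_trans (rn_L1int_le _) _; exact: P_le.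
have rn_ce u : rn (coef u *: e) = rnorm (coef u) by rewrite rnZ e1 mulr1.
have S0A u : S0 u - A u = (P (res C u) - A (res C u)) + coef (res C u) *: e.
  rewrite /S0 -[X in _ - A X](res_split u mC) (linearD A) opprD.
  rewrite [- A _ - A _]addrC addrA [A (res (~` C) u) + _]addrC addrK.
  by rewrite addrAC.
exists S, y1, x1; split; split => //.
(* The crude bound 4 is enough for [bounded_on_pos]; the sharp constant 1 is checked on positive
   functions. *)
- move=> u; rewrite -[leRHS]mul1r; move: u.
  apply: (@bounded_on_pos _ _ _ _ _ _ S 4) => u.
    rewrite SE -(rn_split u mC) mulrDr [4 * _ + _]addrC.
    apply: le_trans (rnD _ _) _; apply: lerD.
      by apply: le_trans (A_le _) _; apply: ler_peMl; [exact: rn_ge0|rewrite ler1n].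
    apply: le_trans (rnD _ _) _; rewrite rn_ce.
    have := P_le (res C u); have := rn_coef (res C u); have := rn_ge0 (res C u).
    by move: (rn (P _)) (rnorm _) (rn (res C u)); clear => *; lra.
  move=> pu; have pC : pos (res C u) by exact: pos_res.
  have CC : res C (res C u) = res C u by exact: res_idem.
  rewrite SE mul1r -(rn_split u mC) [rn _ + rn _]addrC.
  apply: le_trans (rnD _ _) _; apply: lerD; first exact: A_le.
  apply: le_trans (rnD _ _) _; rewrite rn_ce coef_pos// rnorm_of_real ger0_norm ?subr_ge0//.
  by rewrite addrC subrK.
- move=> v; rewrite y1E -(rn_split v mG); apply: le_trans (rnD _ _) _; apply: lerD.
    exact: rn_L1int_le.
  exact: y0_le.
(* Both pieces have norm [1 - h <= a]: the rescaling on [C] and the part removed outside it. *)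
- have -> : x1 - x0 = of_real k (h^-1 - 1) *: res C x0 - res (~` C) x0.
    rewrite /x1 -{2}(res_split x0 mC) opprD addrA; congr (_ - _).
    by rewrite of_realB of_real1 scalerBl scale1r.
  apply: le_trans (rnB _ _) _; rewrite rnZ rnorm_of_real -/h ger0_norm; last first.
    by rewrite subr_ge0 invf_ge1//; have := rn_ge0 (res (~` C) x0); lra.
  rewrite mulrBl mulVf ?gt_eqF// mul1r; lra.
- pose D : {linear L1n -> K^o} := y1 \- y0.
  have DE v : D v = L1int (res G v) - y0 (res G v).
    rewrite [D v](_ : _ = y1 v - y0 v)// y1E -[X in _ - y0 X](res_split v mG).
    by rewrite (linearD y0) opprD addrACA subrr addr0.
  apply: (@bounded_on_pos _ _ _ _ _ _ D 2) => v.
    rewrite DE mulrDl mul1r; apply: le_trans (rnB _ _) _.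
    by apply: lerD; apply: le_trans (rn_Mul_le _ v); [exact: rn_L1int_le|exact: y0_le].
  move=> pv; have pG : pos (res G v) by exact: pos_res.
  have GG : res G (res G v) = res G v by exact: res_idem.
  (* On [G], [y0] has real part at least [(1 - a^2 / 2)] times the norm, hence is within a fraction
     [a] of the integral. *)
  rewrite DE [L1int _]pG rn_distC; apply: (@le_trans _ _ (a * rn (res G v))).
    by apply: rnorm_sub_of_real; [exact: rn_ge0|exact: ltW|exact: y0_le|exact: coneG].
  have := rn_ge0 (res G v); have : rn (res G v) <= rn v by exact: rn_Mul_le.
  by move: (rn (res G v)) (rn v) a0; clear => *; nra.
- pose D : {linear L1m -> L1n} := S \- A.
  have DE u : D u = (P (res C u) - A (res C u)) + coef (res C u) *: e.
    by rewrite -S0A -SE.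
  apply: (@bounded_on_pos _ _ _ _ _ _ D 4) => u.
    rewrite DE; apply: le_trans (rnD _ _) _; rewrite rn_ce.
    have h1 : rn (P (res C u) - A (res C u)) <= 2 * rn (res C u).
      by apply: le_trans (rnB _ _) _; rewrite mulrDl mul1r; apply: lerD.
    have := rn_coef (res C u); have : rn (res C u) <= rn u by exact: rn_Mul_le.
    by move: h1; move: (rn (P _ - _)) (rnorm _) (rn (res C u)) (rn u); clear => *; lra.
  move=> pu; have pC : pos (res C u) by exact: pos_res.
  have CC : res C (res C u) = res C u by exact: res_idem.
  rewrite DE; apply: le_trans (rnD _ _) _.
  rewrite rn_ce coef_pos// rnorm_of_real ger0_norm ?subr_ge0//.
  have := rn_triangle_le (PGA _ pC CC) (GAA _ pC CC); have := Plow _ pC CC.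
  have := rn_ge0 (res C u); have : rn (res C u) <= rn u by exact: rn_Mul_le.
  (* The distance is at most [3a/2 + b] from [P - A], plus [b + 3a/2] from the rank-one term;
     [b <= a / 4] keeps the sum below [4 a]. *)
  move: (rn (P _ - _)) (rn (P _)) (rn (res C u)) (rn u) => r1 r2 r3 r4 h1 h2 h3 h4.
  have : b * r3 <= a / 4 * r3 by rewrite ler_wpM2r.
  have : a * r3 <= a * r4 by rewrite ler_wpM2l// ltW.
  have : 0 <= a * r3 by rewrite mulr_ge0// ltW.
  by move: h3 h4; rewrite mulrDl -!mulrA; clear => *; lra.
Qed.

End PositiveCase.

(** * Reduction to the positive case by unimodular multipliers *)

Theorem corollary2p5 (R : realType) (k : scalarKind)
    (d : measure_display) (T : measurableType d) (mu : {measure set T -> \bar R})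
    (d' : measure_display) (U : measurableType d') (nu : {measure set U -> \bar R}) :
  BPBZp (L1 k mu) (L1 k nu).
Proof.
move=> eps eps0.
have epsE : of_real k (rnorm eps) = eps by rewrite of_real_rnorm gtr0_norm.
have re0 : 0 < rnorm eps by rewrite -(ltr_of_real k) epsE of_real0.
(* Dividing by 5 makes [4 * a < rnorm eps] strict. *)
pose a := Num.min (1 / 2) (rnorm eps / 5).
have a0 : 0 < a by rewrite lt_min !divr_gt0.
have a1 : a <= 1 / 2 by rewrite ge_min lexx.
have a4 : 4 * a < rnorm eps.
  by have : a <= rnorm eps / 5 by [rewrite ge_min lexx orbT]; lra.
pose eta := a * (a ^+ 2 / 2) ^+ 2 / 2.
have eta0 : 0 < eta by rewrite divr_gt0// mulr_gt0// exprn_gt0// divr_gt0// exprn_gt0.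
exists (of_real k eta); split; first by rewrite -(of_real0 R k) ltr_of_real.
move=> A y0 x0 bA A1 cy y1 x0n Ay.
have by0 : bounded_operator y0 by apply/linear_bounded_continuous.
have A_le := contraction_of_opnorm1 bA A1.
have y0_le := contraction_of_opnorm1 by0 y1.
have x01 : rn x0 = 1 by rewrite /rn x0n -(of_real1 R k) re_part_of_real.
(* Besides the two multipliers, the scalar [z] rotates [y0], so that the hypothesis on a modulus
   becomes one on a real part. *)
pose s := phase (repr x0); pose r := phase (repr (A x0)); pose z := csgn (y0 (A x0)).
have us : unimodular s by exact: unimodular_phase.
have ur : unimodular r by exact: unimodular_phase.
have us' := unimodular_inv us; have ur' := unimodular_inv ur.
set s' := fun x => (s x)^-1 in us'; set r' := fun x => (r x)^-1 in ur'.
have ss' f : Mul s (Mul s' f) = f by exact: MulVK.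
have s's f : Mul s' (Mul s f) = f by exact: MulK.
have rr' f : Mul r (Mul r' f) = f by exact: MulVK.
have r'r f : Mul r' (Mul r f) = f by exact: MulK.
have z1 : rnorm z = 1 by exact: rnorm_csgn.
have z0 : z != 0 by exact: csgn_unit.
have [B BE] : exists F : {linear L1 k mu -> L1 k nu}, forall u, F u = Mul r (A (Mul s' u)).
  have lF : linear (fun u => Mul r (A (Mul s' u)) : L1 k nu).
    by move=> c u v; rewrite (linearP (Mul s')) (linearP A) (linearP (Mul r)).
  by exists (linear_pack lF).
have [w wE] : exists F : {linear L1 k nu -> (scalarField R k)^o},
    forall v, F v = z * y0 (Mul r' v).
  have lF : linear (fun v => z * y0 (Mul r' v) : (scalarField R k)^o).
    move=> c u v; rewrite (linearP (Mul r')) (linearP y0) mulrDr; congr (_ + _).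
    exact: mulrCA.
  by exists (linear_pack lF).
pose x := L1abs x0.
have Bx : B x = L1abs (A x0) by rewrite BE /x /L1abs s's.
have B_le u : rn (B u) <= rn u by rewrite BE rn_Mul// (le_trans (A_le _))// rn_Mul.
have w_le v : rn (w v) <= rn v.
  by rewrite wE rnK rnormM z1 mul1r (le_trans (y0_le _))// rn_Mul.
have px : pos x by exact: pos_L1abs.
have x1 : rn x = 1 by rewrite rn_L1abs.
have pBx : pos (B x) by rewrite Bx; exact: pos_L1abs.
have wBx : 1 - eta <= re_part (w (B x)).
  rewrite wE Bx r'r csgnM re_part_of_real -(ler_of_real k) of_real_rnorm.
  by rewrite of_realB of_real1 ltW.
have [S [v [u [[S_le v_le u1 vSu] [ux vw SB]]]]] :=
  positive_case B_le w_le px x1 pBx a0 a1 wBx.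
have [S' S'E] : exists F : {linear L1 k mu -> L1 k nu}, forall u, F u = Mul r' (S (Mul s u)).
  have lF : linear (fun u => Mul r' (S (Mul s u)) : L1 k nu).
    by move=> c f g; rewrite (linearP (Mul s)) (linearP S) (linearP (Mul r')).
  by exists (linear_pack lF).
have [v' v'E] : exists F : {linear L1 k nu -> (scalarField R k)^o},
    forall f, F f = z^-1 * v (Mul r f).
  have lF : linear (fun f => z^-1 * v (Mul r f) : (scalarField R k)^o).
    move=> c f g; rewrite (linearP (Mul r)) (linearP v) mulrDr; congr (_ + _).
    exact: mulrCA.
  by exists (linear_pack lF).
pose u' := Mul s' u.
have S'_le f : rn (S' f) <= rn f by rewrite S'E rn_Mul// (le_trans (S_le _))// rn_Mul.
have v'_le f : rn (v' f) <= rn f.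
  by rewrite v'E rnK rnormM rnormV z1 invr1 mul1r (le_trans (v_le _))// rn_Mul.
have u'1 : rn u' = 1 by rewrite rn_Mul.
(* Undoing the rotation leaves a unimodular value, which suffices. The same pair [u'], [S' u'] then
   shows that [S'] and [v'] both have norm exactly 1. *)
have vSu' : v' (S' u') = z^-1 by rewrite v'E S'E /u' ss' rr' vSu mulr1.
have rz : rn (v' (S' u')) = 1 by rewrite vSu' rnK rnormV z1 invr1.
have S'u'1 : rn (S' u') <= 1 by rewrite -u'1; exact: S'_le.
have [bS S1] : bounded_operator S' /\ opnorm S' = 1.
  by apply: (opnorm1 (x := u')); rewrite ?u'1// -rz.
have [bv v1] : bounded_operator v' /\ opnorm v' = 1.
  by apply: (opnorm1 (x := S' u')); rewrite ?rz.
have normE (V : normedModType (scalarField R k)) (f : V) : `|f| = of_real k (rn f).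
  by rewrite of_real_rn.
have four0 : 0 <= 4 * a by rewrite mulr_ge0// ltW.
have lt_eps (M : scalarField R k) : M <= of_real k (4 * a) -> M < eps.
  by move/le_lt_trans; apply; rewrite -epsE ltr_of_real.
exists S', v', u'; split; split => //.
- exact/linear_bounded_continuous.
- by rewrite normE u'1 of_real1.
- by rewrite normE rz of_real1.
- apply: lt_eps; rewrite normE ler_of_real; apply: le_trans ux.
  by rewrite -[leLHS](rn_Mul _ us) (linearB (Mul s)) /= /u' ss'.
- apply: lt_eps; apply: opnorm_le => //; first exact: linearP.
  move=> f; have := vw (Mul r f); rewrite rn_Mul//; apply: le_trans.
  rewrite [_ f](_ : _ = v' f - y0 f)// wE r'r v'E !rnK.
  by rewrite -[leLHS]mul1r -[X in X * _]z1 -rnormM mulrBr mulVKf.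
- apply: lt_eps; apply: opnorm_le => //; first exact: linearP.
  move=> f; have := SB (Mul s f); rewrite rn_Mul// BE s's; apply: le_trans.
  by rewrite [_ f](_ : _ = S' f - A f)// -[leLHS](rn_Mul _ ur) (linearB (Mul r)) /= S'E rr'.
Qed.
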